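(* Let $\alpha,a,b,c,\beta,\gamma,u,v$ be complex parameters. Then \begin{align*} &\sum_{n=0}^\infty \frac{\bigl(1-\alpha q^{2n}\bigr)(\alpha, q/a, q/b, q/c; q)_n}{(1-\alpha)(q, \alpha a, \alpha b, \alpha c; q)_n}\biggl(\frac{\alpha abc}{q^2}\biggr)^n \sum_{k=0}^{n} \frac{(q^{-n}, \alpha q^n, \beta, \gamma; q)_k\, q^k}{(q, q/a, q/b, \beta \gamma uv; q)_k}\, {}_3\phi_2 \biggl({{q^{-k}, 1/u, 1/v}\atop{\beta, \gamma}}; q, \beta \gamma uv q^k\biggr)\\ &\qquad=\frac{(q\alpha, \alpha ac/q, \alpha bc/q, \alpha \beta ab/q, \alpha \gamma ab/q, \beta \gamma cuv/q; q )_\infty}{\bigl(\alpha a, \alpha b, \alpha c, \alpha \beta abc/q^2, \alpha \gamma abc/q^2, \beta \gamma uv; q \bigr)_\infty}\, {}_3\phi_2 \biggl({{q/c, \alpha ab/(qu), \alpha ab/(qv)}\atop{\alpha \beta ab/q, \alpha \gamma ab/q}}; q, \beta \gamma cuv/q \biggr), \end{align*} provided the series on both sides converge absolutely.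
   Context: Throughout, $q$ is a complex number with $0<|q|<1$. For $x\in\mathbb{C}$, $(x;q)_\infty=\prod_{k=0}^\infty(1-xq^k)$ and, for an integer $n\ge 0$, $(x;q)_n=(x;q)_\infty/(xq^n;q)_\infty=\prod_{k=0}^{n-1}(1-xq^k)$; also $(x_1,\dots,x_m;q)_n=(x_1;q)_n\cdots(x_m;q)_n$ for $n$ an integer or $\infty$. The basic hypergeometric series is ${}_r\phi_s\Bigl({{a_1,\dots,a_r}\atop{b_1,\dots,b_s}};q,z\Bigr)=\sum_{n=0}^\infty \frac{(a_1,\dots,a_r;q)_n}{(q,b_1,\dots,b_s;q)_n}\bigl((-1)^nq^{n(n-1)/2}\bigr)^{1+s-r}z^n$. *)

(* Defs.v *)
From Stdlib Require Import Reals ClassicalEpsilon.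
From Coquelicot Require Import Coquelicot.
Open Scope C_scope.

Fixpoint cpow (x : C) (n : nat) : C :=
  match n with O => 1 | S m => x * cpow x m end.

Fixpoint qpoch (x q : C) (n : nat) : C :=
  match n with O => 1 | S m => qpoch x q m * (1 - x * cpow q m) end.

(* the limit of a complex sequence (chosen classically; meaningful when it exists) *)
Definition climit (u : nat -> C) : C :=
  epsilon (inhabits (0 : C)) (fun l => filterlim u eventually (locally l)).

(* the sum of a complex series (chosen classically; meaningful when it converges) *)
Definition csum (a : nat -> C) : C :=
  epsilon (inhabits (0 : C)) (fun l => is_series a l).

Definition qpinf (x q : C) : C := climit (fun n => qpoch x q n).

(* n-th term of 3phi2 [a1,a2,a3; b1,b2; q, z]  (here 1+s-r = 0) *)
Definition phi32_term (a1 a2 a3 b1 b2 q z : C) (n : nat) : C :=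
  (qpoch a1 q n * qpoch a2 q n * qpoch a3 q n)
  / (qpoch q q n * qpoch b1 q n * qpoch b2 q n) * cpow z n.

Definition phi32 (a1 a2 a3 b1 b2 q z : C) : C := csum (phi32_term a1 a2 a3 b1 b2 q z).

Definition lhs_term (q al a b c be ga u v : C) (n : nat) : C :=
  (1 - al * cpow q (2 * n)) * (qpoch al q n * qpoch (q / a) q n * qpoch (q / b) q n * qpoch (q / c) q n)
  / ((1 - al) * (qpoch q q n * qpoch (al * a) q n * qpoch (al * b) q n * qpoch (al * c) q n))
  * cpow (al * a * b * c / (q * q)) n
  * sum_n (fun k =>
      (qpoch (/ cpow q n) q k * qpoch (al * cpow q n) q k * qpoch be q k * qpoch ga q k * cpow q k)
      / (qpoch q q k * qpoch (q / a) q k * qpoch (q / b) q k * qpoch (be * ga * u * v) q k)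
      * phi32 (/ cpow q k) (/ u) (/ v) be ga q (be * ga * u * v * cpow q k)) n.

Definition rhs_phi_term (q al a b c be ga u v : C) : nat -> C :=
  phi32_term (q / c) (al * a * b / (q * u)) (al * a * b / (q * v))
             (al * be * a * b / q) (al * ga * a * b / q) q (be * ga * c * u * v / q).

Definition rhs_prefactor (q al a b c be ga u v : C) : C :=
  (qpinf (q * al) q * qpinf (al * a * c / q) q * qpinf (al * b * c / q) q
   * qpinf (al * be * a * b / q) q * qpinf (al * ga * a * b / q) q * qpinf (be * ga * c * u * v / q) q)
  / (qpinf (al * a) q * qpinf (al * b) q * qpinf (al * c) q
     * qpinf (al * be * a * b * c / (q * q)) q * qpinf (al * ga * a * b * c / (q * q)) q
     * qpinf (be * ga * u * v) q).

(* Main.v *)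
Require Import Defs.
From Stdlib Require Import Reals Lra Lia Classical ClassicalEpsilon FunctionalExtensionality.
From Coquelicot Require Import Coquelicot.
Open Scope C_scope.

(* With [c = q^(N+1)] both sides terminate.  Interchanging the sums on the left,
   the inner sum over [n] is a terminating 6phi5, and with [X = al a b / q] what
   remains is a convolution [sum_k [N,k] (X)_(N-k) X^k Phi_k], where [Phi_k] is
   [(be, ga)_k / (be ga u v)_k] times the given 3phi2.  A Sears transformation
   rewrites [Phi_k] so that the q-Vandermonde sum evaluates the convolution: it
   dilates [be, ga, 1/u, 1/v] by [X], which gives the right-hand side.

   For general [c], multiply by the infinite products in the denominators that
   depend on [c].  Both sides are then series in the polynomials
   [c^n (q/c; q)_n], and absolute convergence at one nonzero [c] which is not a
   [q^(j+1)] makes them absolutely convergent power series on the closed disc of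
   radius [|c|].  They agree at [q^(N+1)] for all large [N], hence on the disc. *)

(** * Finite sums and q-shifted factorials *)

(** The dilation works because, with [U = 1/u] and [V = 1/v], the quantities [p = be u], [r = be v]
    and [w = be ga u v] are the ratios [be/U], [be/V] and [be ga/(U V)]: a common factor on
    [be, ga, U, V] leaves [p] and [r] and [w] fixed. The transformed polynomial has [p, r, w] as its
    other parameters, so the scale is confined to two simple factors.

    The obstacle in the continuation is that the points [q^(N+1)] accumulate at 0, where [(q/c)_n]
    is singular. Regrouped with [c^n] it becomes [(c - q)...(c - q^n)], and [(al c)_inf / (al c)_n]
    is the entire function [(al c q^n)_inf]; so 0 turns into an interior point. On the disc of
    radius [|c|] the norm of that polynomial exceeds its modulus at [c] by at most a factor bounded
    in [n], provided that no [(q/c)_n] vanishes. This carries absolute convergence from the single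
    point [c] to the disc, and it is why [c = q^(j+1)] is left to the terminating case. As [c] lies
    on the boundary circle, analyticity in the open disc would not reach it. *)

(* Sums are typed in the carrier of a canonical structure, which [ring] and
   [field] do not recognise as [C]. *)
Ltac to_C := match goal with |- @eq _ ?x ?y => change (@eq C x y) | _ => idtac end.
Ltac cring := to_C; ring.
Ltac cfield := to_C; field.

Lemma Csum_S (f : nat -> C) n : sum_n f (S n) = sum_n f n + f (S n).
Proof. exact (sum_Sn f n). Qed.

Lemma Csum_O (f : nat -> C) : sum_n f 0 = f 0%nat.
Proof. exact (sum_O f). Qed.

Lemma Csum_mult_l (x : C) (f : nat -> C) n :
  sum_n (fun k => x * f k) n = x * sum_n f n.
Proof. exact (sum_n_mult_l (K := C_Ring) x f n). Qed.

Lemma Csum_plus (f g : nat -> C) n :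
  sum_n (fun k => f k + g k) n = sum_n f n + sum_n g n.
Proof. exact (sum_n_plus f g n). Qed.

Lemma Csum_ext (f g : nat -> C) n :
  (forall k, (k <= n)%nat -> f k = g k) -> sum_n f n = sum_n g n.
Proof. exact (sum_n_ext_loc f g n). Qed.

Lemma Csum_shift (f : nat -> C) n :
  sum_n f (S n) = f 0%nat + sum_n (fun k => f (S k)) n.
Proof.
  induction n as [|n IH].
  - now rewrite Csum_S, !Csum_O.
  - rewrite Csum_S, IH, Csum_S. cring.
Qed.

Lemma Csum_rev (f : nat -> C) n : sum_n f n = sum_n (fun k => f (n - k)%nat) n.
Proof.
  revert f; induction n as [|n IH]; intros f.
  - now rewrite !Csum_O.
  - rewrite Csum_S, Csum_shift, IH, Nat.sub_0_r. simpl. cring.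
Qed.

Lemma Csum_triangle (F : nat -> nat -> C) N :
  sum_n (fun k => sum_n (F k) k) N
  = sum_n (fun j => sum_n (fun m => F (j + m)%nat j) (N - j)) N.
Proof.
  induction N as [|N IH].
  - now rewrite !Csum_O.
  - rewrite Csum_S, IH, !Csum_S, Nat.sub_diag, Csum_O, Nat.add_0_r.
    rewrite Cplus_assoc; f_equal.
    rewrite <- Csum_plus. apply Csum_ext; intros k Hk.
    rewrite (Nat.sub_succ_l k N Hk), Csum_S.
    now replace (k + S (N - k))%nat with (S N) by lia.
Qed.

Lemma csum_unique (f : nat -> C) (l : C) : is_series f l -> csum f = l.
Proof.
  intros H. unfold csum.
  assert (H' := epsilon_spec (inhabits (0 : C)) _ (ex_intro (fun l => is_series f l) l H)).
  exact (filterlim_locally_unique _ _ _ H' H).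
Qed.

Lemma Cseries_finite (f : nat -> C) N :
  (forall n, (N < n)%nat -> f n = 0) -> is_series f (sum_n f N : C).
Proof.
  intros H.
  assert (E : forall n, (N <= n)%nat -> sum_n f N = sum_n f n).
  { intros n Hn. induction Hn as [|n Hn IH]; [reflexivity|].
    rewrite Csum_S, <- IH, H by lia. symmetry; apply Cplus_0_r. }
  apply filterlim_ext_loc with (fun _ : nat => sum_n f N); [|apply filterlim_const].
  exists N. exact E.
Qed.

Lemma csum_finite (f : nat -> C) N :
  (forall n, (N < n)%nat -> f n = 0) -> csum f = sum_n f N.
Proof. intros H. now apply csum_unique, Cseries_finite. Qed.

Lemma Cmult_cancel_l (z x y : C) : z <> 0 -> z * x = z * y -> x = y.
Proof.
  intros Hz H. replace x with (/ z * (z * x)) by (field; exact Hz).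
  rewrite H. field. exact Hz.
Qed.

Lemma cpow_add (x : C) m n : cpow x (m + n) = cpow x m * cpow x n.
Proof. induction m as [|m IH]; simpl; [cring | rewrite IH; cring]. Qed.

Lemma cpow_mul (x y : C) n : cpow (x * y) n = cpow x n * cpow y n.
Proof. induction n as [|n IH]; simpl; [cring | rewrite IH; cring]. Qed.

Lemma cpow_1 n : cpow 1 n = 1.
Proof. induction n as [|n IH]; simpl; [|rewrite IH]; cring. Qed.

Lemma cpow_nz (x : C) n : x <> 0 -> cpow x n <> 0.
Proof.
  intros Hx; induction n as [|n IH]; simpl.
  - apply C1_nz.
  - now apply Cmult_neq_0.
Qed.

Lemma qpoch_add (x q : C) m n :
  qpoch x q (m + n) = qpoch x q m * qpoch (x * cpow q m) q n.
Proof.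
  induction n as [|n IH]; simpl.
  - rewrite Nat.add_0_r; cring.
  - rewrite Nat.add_succ_r; simpl. rewrite IH, cpow_add; cring.
Qed.

Lemma qpoch_Sl (x q : C) n : qpoch x q (S n) = (1 - x) * qpoch (x * q) q n.
Proof.
  change (S n) with (1 + n)%nat. rewrite qpoch_add. simpl.
  rewrite !Cmult_1_r, Cmult_1_l. reflexivity.
Qed.

Lemma qpoch_0 (q : C) n : qpoch 0 q n = 1.
Proof. induction n as [|n IH]; simpl; [|rewrite IH]; cring. Qed.

(** * q-binomial coefficients, the q-Vandermonde sum and the Sears transformation *)

Definition qbin (q : C) (N k : nat) : C :=
  qpoch q q N / (qpoch q q k * qpoch q q (N - k)).

(* [(-1)^k q^(k(k-1)/2)] *)
Fixpoint qsgn (q : C) (k : nat) : C :=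
  match k with O => 1 | S m => - cpow q m * qsgn q m end.

Lemma qsgn_add (q : C) i j : qsgn q (i + j) = qsgn q i * qsgn q j * cpow (cpow q j) i.
Proof.
  induction i as [|i IH]; simpl; [cring|].
  rewrite IH, cpow_add; cring.
Qed.

Section Finite.
Context (q : C) (Hq : forall n, qpoch q q n <> 0).

Lemma one_minus_qS n : 1 - q * cpow q n <> 0.
Proof. intros H; apply (Hq (S n)); simpl; rewrite H; cring. Qed.

(** Splits [1 - q^(M+1)] as [(1 - q^m) q^(M+1-m) + (1 - q^(M+1-m))]; each part cancels a factor of
    [qbin q (S M) m]. The rule is stated under a sum because truncated subtraction makes
    [qbin q M (S M)] nonzero, so the pointwise rule fails at the edge; here the edge terms carry a
    zero factor. *)
Lemma qbin_pascal_sum (f : nat -> C) M :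
  sum_n (fun m => qbin q (S M) m * f m) (S M)
  = sum_n (fun m => qbin q M m * (cpow q (M - m) * f (S m) + f m)) M.
Proof.
  assert (H0 := one_minus_qS M).
  apply Cmult_cancel_l with (1 - q * cpow q M); [exact H0|].
  rewrite <- !Csum_mult_l.
  set (g m := qbin q (S M) m * ((1 - cpow q m) * cpow q (S M - m) * f m)).
  set (h m := qbin q (S M) m * ((1 - cpow q (S M - m)) * f m)).
  rewrite (Csum_ext _ (fun m => g m + h m)).
  2:{ intros k Hk. unfold g, h.
      replace (q * cpow q M) with (cpow q k * cpow q (S M - k)).
      - cring.
      - rewrite <- cpow_add. now replace (k + (S M - k))%nat with (S M) by lia. }
  rewrite Csum_plus, Csum_shift, (Csum_S h).
  replace (g 0%nat) with (RtoC 0) by (unfold g; simpl; cring).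
  replace (h (S M)) with (RtoC 0)
    by (unfold h; rewrite Nat.sub_diag; simpl; cring).
  rewrite Cplus_0_l, Cplus_0_r, <- Csum_plus.
  apply Csum_ext; intros k Hk. unfold g, h, qbin.
  rewrite (Nat.sub_succ_l k M Hk), Nat.sub_succ. simpl.
  assert (H1 := one_minus_qS k). assert (H2 := one_minus_qS (M - k)).
  cfield. auto.
Qed.

(** After the Pascal step the two occurrences of [X q^(M-k)] cancel, so every summand acquires the
    same factor [1 - X y q^M], and the recursion holds term by term. *)
Lemma qvandermonde (X y : C) M :
  sum_n (fun m => qbin q M m * (qpoch X q (M - m) * cpow X m * qpoch y q m)) M
  = qpoch (X * y) q M.
Proof.
  induction M as [|M IH].
  - rewrite Csum_O. unfold qbin; simpl. cfield.
  - rewrite (qbin_pascal_sum (fun m => qpoch X q (S M - m) * cpow X m * qpoch y q m)).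
    simpl qpoch at 5. rewrite <- IH, Cmult_comm, <- Csum_mult_l.
    apply Csum_ext; intros k Hk.
    rewrite (Nat.sub_succ_l k M Hk), Nat.sub_succ.
    replace (cpow q M) with (cpow q (M - k) * cpow q k)
      by (rewrite <- cpow_add; f_equal; lia).
    simpl. cring.
Qed.

Lemma qvandermonde_1 (X : C) M :
  sum_n (fun m => qbin q M m * (qpoch X q m * cpow X (M - m))) M = RtoC 1.
Proof.
  rewrite Csum_rev, <- (qpoch_0 q M), <- (Cmult_0_r X), <- qvandermonde.
  apply Csum_ext; intros k Hk. rewrite qpoch_0.
  replace (M - (M - k))%nat with k by lia.
  unfold qbin. replace (M - (M - k))%nat with k by lia.
  cfield. auto.
Qed.

(** The finite q-binomial theorem. It serves to expand one lower parameter of [sears_poly] in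
    powers. *)
Lemma qpoch_expand (y : C) n :
  qpoch y q n = sum_n (fun i => qbin q n i * (qsgn q i * cpow y i)) n.
Proof.
  induction n as [|n IH].
  - rewrite Csum_O. unfold qbin; simpl. cfield.
  - rewrite (qbin_pascal_sum (fun i => qsgn q i * cpow y i)).
    simpl. rewrite IH, Cmult_comm, <- Csum_mult_l.
    apply Csum_ext; intros k Hk.
    replace (cpow q n) with (cpow q (n - k) * cpow q k)
      by (rewrite <- cpow_add; f_equal; lia).
    cring.
Qed.

(** Both products of q-binomials equal the q-trinomial coefficient of the parts [j], [k - j],
    [N - k]. Indexing [h] by these three parts makes every later interchange of sums an instance of
    this one. *)
Lemma qbin_assoc (h : nat -> nat -> nat -> C) N :
  sum_n (fun k => qbin q N k
     * sum_n (fun j => qbin q k j * h j (k - j)%nat (N - k)%nat) k) N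
  = sum_n (fun j => qbin q N j
     * sum_n (fun m => qbin q (N - j) m * h j m (N - j - m)%nat) (N - j)) N.
Proof.
  rewrite (Csum_ext _ (fun k => sum_n (fun j =>
    qbin q N k * (qbin q k j * h j (k - j)%nat (N - k)%nat)) k)).
  2:{ intros; now rewrite Csum_mult_l. }
  rewrite (Csum_triangle (fun k j =>
    qbin q N k * (qbin q k j * h j (k - j)%nat (N - k)%nat))).
  apply Csum_ext; intros j Hj. rewrite <- Csum_mult_l.
  apply Csum_ext; intros m Hm.
  replace (j + m - j)%nat with m by lia.
  replace (N - (j + m))%nat with (N - j - m)%nat by lia.
  unfold qbin.
  replace (j + m - j)%nat with m by lia.
  replace (N - (j + m))%nat with (N - j - m)%nat by lia.
  cfield. auto.
Qed.

Lemma qbin_rev_sum (f : nat -> C) N :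
  sum_n (fun k => qbin q N k * f k) N = sum_n (fun k => qbin q N k * f (N - k)%nat) N.
Proof.
  rewrite Csum_rev. apply Csum_ext; intros k Hk. unfold qbin.
  replace (N - (N - k))%nat with k by lia. cfield. auto.
Qed.

(* Splitting [(be q^j)_(m-j)] by [qvandermonde] with [be = r V] merges
   [(V)_j (V q^j)_i] into [(V)_(i+j)]; the sum over [j] is then [qvandermonde_1]. *)
Lemma sears_coefficient (be ga w U V r : C) m :
  be = r * V -> ga * r = U * w ->
  sum_n (fun j => qbin q m j * (qpoch (be * cpow q j) q (m - j)
     * qpoch U q j * qpoch V q j * cpow w j * cpow ga (m - j))) m
  = sum_n (fun l => qbin q m l * (qpoch r q (m - l) * qpoch V q l
     * cpow ga (m - l) * cpow w l)) m.
Proof.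
  intros Hbe Hga.
  set (h := fun j i s : nat => qpoch r q s * cpow r i * qpoch V q (j + i)
       * qpoch U q j * cpow w j * cpow ga (i + s)).
  transitivity (sum_n (fun j => qbin q m j
    * sum_n (fun i => qbin q (m - j) i * h j i (m - j - i)%nat) (m - j)) m).
  - unfold h; apply Csum_ext; intros j Hj. f_equal.
    replace (be * cpow q j) with (r * (V * cpow q j)) by (rewrite Hbe; cring).
    rewrite <- qvandermonde, <- !Cmult_assoc, Cmult_comm, <- Csum_mult_l.
    apply Csum_ext; intros i Hi. rewrite qpoch_add.
    replace (i + (m - j - i))%nat with (m - j)%nat by lia. cring.
  - rewrite <- (qbin_assoc h). unfold h. apply Csum_ext; intros l Hl. f_equal.
    rewrite <- (Cmult_1_r (qpoch r q (m - l) * _ * _ * _)), <- (qvandermonde_1 U l).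
    rewrite <- Csum_mult_l. apply Csum_ext; intros j Hj.
    replace (j + (l - j))%nat with l by lia.
    rewrite cpow_add.
    replace (cpow w l) with (cpow w j * cpow w (l - j))
      by (rewrite <- cpow_add; f_equal; lia).
    assert (H : cpow ga (l - j) * cpow r (l - j) = cpow U (l - j) * cpow w (l - j))
      by (rewrite <- !cpow_mul; now f_equal).
    transitivity (qbin q l j * (qpoch r q (m - l) * qpoch V q l * qpoch U q j
      * cpow w j * cpow ga (m - l) * (cpow ga (l - j) * cpow r (l - j)))); [cring|].
    rewrite H. cring.
Qed.

(** This is [(be, ga)_k] times the terminating 3phi2 with upper parameters [q^(-k), U, V], lower
    parameters [be, ga] and argument [w q^k]. With [be] and [ga] cleared from the denominators, the
    transformation holds without nonvanishing conditions on them. *)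
Definition sears_poly (be ga U V w : C) (k : nat) : C :=
  sum_n (fun j => qbin q k j * (qsgn q j * qpoch (be * cpow q j) q (k - j)
    * qpoch (ga * cpow q j) q (k - j) * qpoch U q j * qpoch V q j * cpow w j)) k.

(** Expand [(ga q^j)_(k-j)] and collect by [m = i + j]. Since [(be q^j)_(k-j)] factors as
    [(be q^j)_(m-j) (be q^m)_(k-m)], the inner sum no longer involves [k]: it is the sum evaluated
    by [sears_coefficient]. *)
Lemma sears_poly_expand (be ga U V w : C) k :
  sears_poly be ga U V w k
  = sum_n (fun m => qbin q k m * (qsgn q m * qpoch (be * cpow q m) q (k - m) *
      sum_n (fun j => qbin q m j * (qpoch (be * cpow q j) q (m - j)
     * qpoch U q j * qpoch V q j * cpow w j * cpow ga (m - j))) m)) k.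
Proof.
  unfold sears_poly.
  set (h := fun j i s : nat => qsgn q (i + j) * qpoch (be * cpow q j) q (i + s)
       * qpoch U q j * qpoch V q j * cpow w j * cpow ga i).
  transitivity (sum_n (fun j => qbin q k j
    * sum_n (fun i => qbin q (k - j) i * h j i (k - j - i)%nat) (k - j)) k).
  - unfold h; apply Csum_ext; intros j Hj. f_equal. rewrite (qpoch_expand (ga * cpow q j)).
    transitivity ((qsgn q j * qpoch (be * cpow q j) q (k - j) * qpoch U q j
      * qpoch V q j * cpow w j) * sum_n (fun i => qbin q (k - j) i
      * (qsgn q i * cpow (ga * cpow q j) i)) (k - j)); [cring|].
    rewrite <- Csum_mult_l. apply Csum_ext; intros i Hi.
    rewrite qsgn_add, cpow_mul.
    replace (i + (k - j - i))%nat with (k - j)%nat by lia. cring.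
  - rewrite <- (qbin_assoc h). unfold h. apply Csum_ext; intros m Hm. f_equal.
    rewrite <- Csum_mult_l. apply Csum_ext; intros j Hj.
    replace (m - j + j)%nat with m by lia.
    rewrite qpoch_add.
    replace (be * cpow q j * cpow q (m - j)) with (be * cpow q m); [cring|].
    replace m with (j + (m - j))%nat at 1 by lia. rewrite cpow_add. cring.
Qed.

(** By [sears_coefficient] each inner coefficient is a convolution of [(r)_i ga^i] with [(V)_l w^l].
    Passing to the parameters on the right exchanges the two sequences, which only reverses the
    order of summation. *)
Lemma sears (be ga U V w p r : C) k :
  be = r * V -> ga * r = U * w -> ga * p = V * w ->
  sears_poly be ga U V w k = sears_poly be w p r ga k.
Proof.
  intros H1 H2 H3. rewrite !sears_poly_expand.
  apply Csum_ext; intros m Hm. do 2 f_equal.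
  rewrite (sears_coefficient be ga w U V r m H1 H2).
  rewrite (sears_coefficient be w ga p r V m).
  - rewrite qbin_rev_sum. apply Csum_ext; intros l Hl.
    replace (m - (m - l))%nat with l by lia. cring.
  - rewrite H1; cring.
  - rewrite Cmult_comm, <- H3; cring.
Qed.

(** Now [w] is a lower parameter, and [(w)_k = (w)_j (w q^j)_(k-j)] cancels. The index [k] survives
    only in the q-binomial and in [(be q^j)_(k-j)], a shape to which [qvandermonde] applies. *)
Lemma sears_poly_quot (be w p r ga : C) k :
  (forall n, qpoch w q n <> 0) ->
  sears_poly be w p r ga k / qpoch w q k
  = sum_n (fun j => qbin q k j * (qsgn q j * qpoch (be * cpow q j) q (k - j)
      * (qpoch p q j * qpoch r q j / qpoch w q j) * cpow ga j)) k.
Proof.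
  intros Hw. unfold sears_poly, Cdiv. rewrite Cmult_comm, <- Csum_mult_l.
  apply Csum_ext; intros j Hj.
  assert (E : qpoch w q k = qpoch w q j * qpoch (w * cpow q j) q (k - j))
    by (rewrite <- qpoch_add; f_equal; lia).
  assert (qpoch (w * cpow q j) q (k - j) <> 0).
  { intros E2; apply (Hw k); rewrite E, E2; cring. }
  rewrite E. cfield. auto.
Qed.

(* [sears] turns the dependence of [sears_poly] on the scale of
   [be, ga, U, V] into the single factor [(be q^j)_(k-j) ga^j]. *)
Lemma sears_poly_dilation (X be ga U V w p r : C) N :
  be = r * V -> ga * r = U * w -> ga * p = V * w ->
  (forall n, qpoch w q n <> 0) ->
  sum_n (fun k => qbin q N k * (qpoch X q (N - k) * cpow X k
     * (sears_poly be ga U V w k / qpoch w q k))) N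
  = sears_poly (X * be) (X * ga) (X * U) (X * V) w N / qpoch w q N.
Proof.
  intros H1 H2 H3 Hw.
  rewrite (sears (X * be) (X * ga) (X * U) (X * V) w p r).
  2:{ rewrite H1; cring. }
  2:{ rewrite <- Cmult_assoc, H2; cring. }
  2:{ rewrite <- Cmult_assoc, H3; cring. }
  rewrite sears_poly_quot by exact Hw.
  set (h := fun j i s : nat => qpoch X q s * cpow X (j + i) * (qsgn q j
      * qpoch (be * cpow q j) q i * (qpoch p q j * qpoch r q j / qpoch w q j)
      * cpow ga j)).
  transitivity (sum_n (fun k => qbin q N k
    * sum_n (fun j => qbin q k j * h j (k - j)%nat (N - k)%nat) k) N).
  - unfold h; apply Csum_ext; intros k Hk. f_equal.
    rewrite (sears be ga U V w p r) by assumption.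
    rewrite sears_poly_quot by exact Hw.
    rewrite <- Csum_mult_l. apply Csum_ext; intros j Hj.
    replace (j + (k - j))%nat with k by lia. cring.
  - rewrite qbin_assoc. unfold h. apply Csum_ext; intros j Hj. f_equal.
    replace (X * be * cpow q j) with (X * (be * cpow q j)) by cring.
    (* With [y = be q^j] the q-Vandermonde sum turns [(be q^j)_m] into [(X be q^j)_(N-j)], while the
       remaining [X^j] dilates [ga^j]. *)
    rewrite <- qvandermonde, cpow_mul.
    transitivity (qsgn q j * (qpoch p q j * qpoch r q j / qpoch w q j)
      * cpow X j * cpow ga j * sum_n (fun m => qbin q (N - j) m *
        (qpoch X q (N - j - m) * cpow X m * qpoch (be * cpow q j) q m)) (N - j)); [|cring].
    rewrite <- Csum_mult_l. apply Csum_ext; intros m Hm. rewrite cpow_add. cring.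
Qed.

(** * The terminating 6phi5 and the terminating case *)

(* [(1 - A q^(2m)) (A; q)_m / (1 - A)] with the removable singularity at
   [A = 1] cancelled. *)
Definition very_well_poised (A q : C) (m : nat) : C :=
  match m with
  | O => 1
  | S m' => (1 - A * (cpow q m * cpow q m)) * qpoch (A * q) q m'
  end.

(* The 6phi5 with base point [A = Y B C / q], so that its argument is [Y / D]
   and its sum contains the factor [(Y; q)_M]. *)
Definition phi65_term (Y B C' D q : C) (m : nat) : C :=
  very_well_poised (Y * B * C' / q) q m
  * (qpoch B q m * qpoch C' q m * qpoch D q m)
  / (qpoch q q m * qpoch (Y * C') q m * qpoch (Y * B) q m
     * qpoch (Y * B * C' / D) q m)
  * cpow (Y / D) m.

Lemma qpoch_neg_vanish (k m : nat) :
  q <> 0 -> (k < m)%nat -> qpoch (/ cpow q k) q m = 0.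
Proof.
  intros Hq0 H. replace m with (k + S (m - k - 1))%nat by lia.
  rewrite qpoch_add, qpoch_Sl, Cinv_l by (now apply cpow_nz). cring.
Qed.

Lemma qpoch_shift_nz (x : C) :
  (forall n, qpoch x q n <> 0) -> forall k n, qpoch (x * cpow q k) q n <> 0.
Proof. intros H k n E; apply (H (k + n)%nat); rewrite qpoch_add, E; cring. Qed.

Lemma qpoch_factor_nz (x : C) :
  (forall n, qpoch x q n <> 0) -> forall n, 1 - x * cpow q n <> 0.
Proof. intros H n E; apply (H (S n)); simpl; rewrite E; cring. Qed.

(** A telescoping certificate: the last term is the defect between the two partial sums, and its
    increment in [n] is a rational identity in [q^n]. Shifting [Y] and [D] together keeps [B], [C'],
    the argument [Y / D] and the lower parameter [Y B C' / D]. For [D = q^(-M-1)] the defect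
    vanishes at [n = M + 1]. *)
Lemma phi65_contiguous (Y B C' D : C) n :
  q <> 0 -> D <> 0 ->
  (forall n, qpoch (Y * C') q n <> 0) -> (forall n, qpoch (Y * B) q n <> 0) ->
  (forall n, qpoch (Y * B * C' / D) q n <> 0) ->
  sum_n (phi65_term Y B C' D q) n
  = (1 - Y * B * C') * (1 - Y) / ((1 - Y * C') * (1 - Y * B))
      * sum_n (phi65_term (Y * q) B C' (D * q) q) n
    + Y * (qpoch (Y * B * C') q n * qpoch B q (S n) * qpoch C' q (S n)
           * qpoch (D * q) q n)
      / (qpoch q q n * qpoch (Y * C') q (S n) * qpoch (Y * B) q (S n)
         * qpoch (Y * B * C' / D) q n) * cpow (Y / D) n.
Proof.
  intros Hq0 HD Ha Hb Hd.
  assert (Fa := qpoch_factor_nz _ Ha). assert (Fb := qpoch_factor_nz _ Hb).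
  assert (Fd := qpoch_factor_nz _ Hd).
  assert (Fa0 : 1 - Y * C' <> 0)
    by (rewrite <- (Cmult_1_r (Y * C')); apply (Fa 0%nat)).
  assert (Fb0 : 1 - Y * B <> 0)
    by (rewrite <- (Cmult_1_r (Y * B)); apply (Fb 0%nat)).
  induction n as [|n IH].
  - rewrite !Csum_O. unfold phi65_term. simpl.
    rewrite !Cmult_1_r. to_C. field. auto.
  - rewrite Csum_S, IH, Csum_S, Cmult_plus_distr_l. clear IH.
    set (S0 := sum_n _ n). clearbody S0.
    rewrite <- !Cplus_assoc; f_equal.
    unfold phi65_term, very_well_poised.
    replace (Y * B * C' / q * q) with (Y * B * C') by (field; auto).
    replace (Y * q * B * C' / q) with (Y * B * C') by (field; auto).
    replace (Y * q * B * C' / (D * q)) with (Y * B * C' / D) by (field; auto).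
    replace (Y * q / (D * q)) with (Y / D) by (field; auto).
    replace (Y * q * C') with (Y * C' * q) by ring.
    replace (Y * q * B) with (Y * B * q) by ring.
    assert (EA : qpoch (Y * B * C' * q) q n * (1 - Y * B * C')
                 = qpoch (Y * B * C') q (S n)) by (rewrite qpoch_Sl; ring).
    assert (Ea : qpoch (Y * C' * q) q (S n)
                 = qpoch (Y * C') q (S (S n)) / (1 - Y * C'))
      by (rewrite (qpoch_Sl (Y * C') q (S n)); field; auto).
    assert (Eb : qpoch (Y * B * q) q (S n)
                 = qpoch (Y * B) q (S (S n)) / (1 - Y * B))
      by (rewrite (qpoch_Sl (Y * B) q (S n)); field; auto).
    rewrite Ea, Eb, (qpoch_Sl D q n).
    (* The factor [1 - Y * B * C'] moves inside to complete [(Y B C' q)_n] to [(Y B C')_(n+1)]. Then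
       all symbols are taken at [n] and can be generalised to plain variables for [field]. *)
    transitivity ((1 - Y) / ((1 - Y * C') * (1 - Y * B)) *
      ((1 - Y * B * C' * (cpow q (S n) * cpow q (S n)))
        * (qpoch (Y * B * C' * q) q n * (1 - Y * B * C'))
        * (qpoch B q (S n) * qpoch C' q (S n) * qpoch (D * q) q (S n))
        / (qpoch q q (S n) * (qpoch (Y * C') q (S (S n)) / (1 - Y * C'))
           * (qpoch (Y * B) q (S (S n)) / (1 - Y * B))
           * qpoch (Y * B * C' / D) q (S n)) * cpow (Y / D) (S n))
      + Y * (qpoch (Y * B * C') q (S n) * qpoch B q (S (S n))
           * qpoch C' q (S (S n)) * qpoch (D * q) q (S n))
      / (qpoch q q (S n) * qpoch (Y * C') q (S (S n)) * qpoch (Y * B) q (S (S n))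
         * qpoch (Y * B * C' / D) q (S n)) * cpow (Y / D) (S n)).
    2:{ f_equal. unfold Cdiv. ring. }
    rewrite EA. clear EA Ea Eb.
    specialize (Fd n). assert (Fa1 := Fa (S n)). assert (Fb1 := Fb (S n)).
    specialize (Fa n). specialize (Fb n). assert (Fq := one_minus_qS n).
    specialize (Hd n). specialize (Ha n). specialize (Hb n). assert (Hqn := Hq n).
    simpl in *.
    generalize dependent (qpoch (Y * B * C' / D) q n). intros d Hd.
    generalize dependent (qpoch (Y * C') q n). intros a' Ha.
    generalize dependent (qpoch (Y * B) q n). intros b' Hb.
    generalize dependent (qpoch q q n). intros q' Hq'.
    generalize (qpoch (Y * B * C') q n) (qpoch (D * q) q n) (qpoch B q n)
      (qpoch C' q n) (cpow (Y / D) n).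
    intros x1 x2 x3 x4 x5.
    generalize dependent (cpow q n). intros x Fa Fb Fd Fa1 Fb1 Fq.
    assert (Fd' : D - Y * B * C' * x <> 0).
    { intros E. apply Fd. replace (1 - Y * B * C' / D * x)
        with ((D - Y * B * C' * x) / D) by (field; auto).
      rewrite E. field. auto. }
    to_C. field. repeat split; auto.
Qed.

(** Each use of [phi65_contiguous] peels off the first factor of every symbol on the right and
    replaces [Y] by [Y q] and [M + 1] by [M]; hence [Y] is quantified inside the induction. *)
Lemma phi65_sum (B C' : C) M : forall Y : C,
  q <> 0 ->
  (forall n, qpoch (Y * C') q n <> 0) -> (forall n, qpoch (Y * B) q n <> 0) ->
  (forall n, qpoch (Y * B * C' * cpow q M) q n <> 0) ->
  sum_n (phi65_term Y B C' (/ cpow q M) q) M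
  = qpoch (Y * B * C') q M * qpoch Y q M / (qpoch (Y * C') q M * qpoch (Y * B) q M).
Proof.
  induction M as [|M IH]; intros Y Hq0 Ha Hb Hd.
  - rewrite Csum_O. unfold phi65_term; simpl. to_C. field. auto.
  - assert (HM := cpow_nz q M Hq0).
    assert (ED : / cpow q (S M) * q = / cpow q M) by (simpl; field; auto).
    rewrite phi65_contiguous; auto.
    3:{ intros n. replace (Y * B * C' / / cpow q (S M)) with (Y * B * C' * cpow q (S M)).
        - apply Hd.
        - simpl; field; auto. }
    2:{ intros E. apply C1_nz. rewrite <- (Cinv_r (cpow q (S M))).
        - rewrite E; ring.
        - now apply cpow_nz. }
    rewrite ED, Csum_S.
    (* [(q^(-M))_(M+1) = 0] removes the defect and also the last summand of the shifted sum, which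
       then stops at [M] as the induction hypothesis requires. *)
    rewrite (qpoch_neg_vanish M (S M)) by (auto; lia).
    replace (phi65_term (Y * q) B C' (/ cpow q M) q (S M)) with (RtoC 0).
    2:{ unfold phi65_term. rewrite (qpoch_neg_vanish M (S M)) by (auto; lia).
        unfold Cdiv; ring. }
    assert (Ea : forall x : C, (forall n, qpoch x q n <> 0) -> 1 - x <> 0).
    { intros x Hx. specialize (Hx 1%nat). simpl in Hx. intros E; apply Hx.
      rewrite Cmult_1_r, E; ring. }
    unfold Cdiv; rewrite !Cmult_0_r, !Cmult_0_l, !Cplus_0_r.
    rewrite IH; auto.
    + replace (Y * q * B * C') with (Y * B * C' * q) by ring.
      replace (Y * q * C') with (Y * C' * q) by ring.
      replace (Y * q * B) with (Y * B * q) by ring.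
      rewrite !qpoch_Sl.
      assert (N1 : qpoch (Y * C' * q) q M <> 0)
        by (intros E; apply (Ha (S M)); rewrite qpoch_Sl, E; ring).
      assert (N2 : qpoch (Y * B * q) q M <> 0)
        by (intros E; apply (Hb (S M)); rewrite qpoch_Sl, E; ring).
      unfold Cdiv. to_C. field. auto.
    + intros n E; apply (Ha (S n)). rewrite qpoch_Sl.
      replace (Y * C' * q) with (Y * q * C') by ring. rewrite E; ring.
    + intros n E; apply (Hb (S n)). rewrite qpoch_Sl.
      replace (Y * B * q) with (Y * q * B) by ring. rewrite E; ring.
    + intros n. replace (Y * q * B * C' * cpow q M) with (Y * B * C' * cpow q (S M))
        by (simpl; ring). apply Hd.
Qed.

Lemma qpoch_neg (N k : nat) :
  q <> 0 -> (k <= N)%nat ->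
  qpoch (/ cpow q N) q k = qsgn q k * qpoch q q N / (qpoch q q (N - k) * cpow (cpow q N) k).
Proof.
  intros Hq0; induction k as [|k IH]; intros Hk.
  - simpl. rewrite Nat.sub_0_r. field. auto.
  - simpl. rewrite IH by lia.
    replace (N - k)%nat with (S (N - S k))%nat by lia. simpl.
    assert (H1 := one_minus_qS (N - S k)).
    assert (HN := cpow_nz q N Hq0). assert (HNk := cpow_nz _ k HN).
    assert (E : cpow q N = cpow q k * (q * cpow q (N - S k))).
    { change (q * cpow q (N - S k)) with (cpow q (S (N - S k))).
      rewrite <- cpow_add. f_equal; lia. }
    assert (Hqk := cpow_nz q k Hq0). assert (Hqs := cpow_nz q (N - S k) Hq0).
    replace (/ cpow q N * cpow q k) with (/ (q * cpow q (N - S k)))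
      by (rewrite E; field; auto).
    replace (cpow q N * cpow (cpow q N) k)
      with (cpow q k * (q * cpow q (N - S k)) * cpow (cpow q N) k) by (rewrite <- E; ring).
    field. auto 10.
Qed.

(** The power [q^(k j)] from the argument cancels the one that [(q^(-k))_j] has in its denominator,
    so only [qsgn q j] and the q-binomial remain. *)
Lemma phi32_terminating (be ga U V w : C) k :
  q <> 0 -> (forall n, qpoch be q n <> 0) -> (forall n, qpoch ga q n <> 0) ->
  qpoch be q k * qpoch ga q k
    * phi32 (/ cpow q k) U V be ga q (w * cpow q k) = sears_poly be ga U V w k.
Proof.
  intros Hq0 Hb Hg. unfold phi32. rewrite (csum_finite _ k).
  2:{ intros n Hn. unfold phi32_term. rewrite (qpoch_neg_vanish k n) by auto.
      unfold Cdiv; ring. }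
  unfold sears_poly. rewrite <- Csum_mult_l. apply Csum_ext; intros j Hj.
  unfold phi32_term. rewrite qpoch_neg by auto. rewrite cpow_mul.
  assert (H : forall x : C, qpoch x q k = qpoch x q j * qpoch (x * cpow q j) q (k - j))
    by (intros x; rewrite <- qpoch_add; f_equal; lia).
  rewrite (H be), (H ga). unfold qbin.
  assert (Hc := cpow_nz _ j (cpow_nz q k Hq0)).
  cfield. auto.
Qed.

(** With [n = k + m], [(al)_n (al q^n)_k = (al)_(2k+m)]. So the outer summand, seen as a function of
    [m], is again very well poised, with base point [al q^(2k)]. *)
Lemma very_well_poised_shift (al : C) k m :
  (1 - al * cpow q (2 * (k + m))) * qpoch al q (k + m) * qpoch (al * cpow q (k + m)) q k
  = (1 - al) * qpoch (al * q) q (k + k)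
      * very_well_poised (al * cpow q (k + k)) q m.
Proof.
  rewrite <- Cmult_assoc, <- qpoch_add.
  replace (2 * (k + m))%nat with (k + k + (m + m))%nat by lia.
  rewrite (cpow_add q (k + k) (m + m)), (cpow_add q m m).
  replace (k + m + k)%nat with (k + k + m)%nat by lia.
  destruct m as [|m].
  - unfold very_well_poised. rewrite Nat.add_0_r. simpl cpow at 2 3.
    rewrite !Cmult_1_r.
    rewrite <- qpoch_Sl. simpl. ring.
  - rewrite Nat.add_succ_r, qpoch_Sl, qpoch_add. unfold very_well_poised.
    replace (al * cpow q (k + k) * q) with (al * q * cpow q (k + k)) by ring. ring.
Qed.

(** * The identity at [c = q^(N+1)] *)

Section Terminating.
Context (al a b be ga u v : C) (N : nat).
Context (Hq0 : q <> 0) (Ha : a <> 0) (Hb : b <> 0) (Hal : al <> 1).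
Context (Hala : forall n, qpoch (al * a) q n <> 0)
  (Halb : forall n, qpoch (al * b) q n <> 0)
  (Halc : forall n, qpoch (al * (q * cpow q N)) q n <> 0)
  (Hqa : forall n, qpoch (q / a) q n <> 0)
  (Hqb : forall n, qpoch (q / b) q n <> 0).

(* The sum over [n = k + m] left after interchanging the two sums of the left-hand side. *)
Lemma inner_phi65 k :
  (k <= N)%nat ->
  sum_n (fun m =>
    (1 - al * cpow q (2 * (k + m)))
    * (qpoch al q (k + m) * qpoch (q / a) q (k + m) * qpoch (q / b) q (k + m)
       * qpoch (/ cpow q N) q (k + m))
    / ((1 - al) * (qpoch q q (k + m) * qpoch (al * a) q (k + m)
       * qpoch (al * b) q (k + m) * qpoch (al * (q * cpow q N)) q (k + m)))
    * cpow (al * a * b / q * cpow q N) (k + m)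
    * (qpoch (/ cpow q (k + m)) q k * qpoch (al * cpow q (k + m)) q k * cpow q k
       / (qpoch q q k * qpoch (q / a) q k * qpoch (q / b) q k))) (N - k)
  = qpoch (al * q) q N / (qpoch (al * a) q N * qpoch (al * b) q N)
    * (qbin q N k * (qpoch (al * a * b / q) q (N - k) * cpow (al * a * b / q) k)).
Proof.
  intros Hk. set (X := al * a * b / q).
  assert (Ez : / cpow q N * cpow q k = / cpow q (N - k)).
  { replace (cpow q N) with (cpow q (N - k) * cpow q k)
      by (rewrite <- cpow_add; f_equal; lia).
    assert (H1 := cpow_nz q k Hq0). assert (H2 := cpow_nz q (N - k) Hq0).
    field. auto. }
  (* The 6phi5 has [Y = X], [B = q^(k+1)/a], [C' = q^(k+1)/b] and [D = q^(k-N)]. These equations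
     identify its lower parameters and its base point. *)
  assert (EB : X * (q / b * cpow q k) = al * a * cpow q k) by (unfold X; field; auto).
  assert (EC : X * (q / a * cpow q k) = al * b * cpow q k) by (unfold X; field; auto).
  assert (EBC : X * (q / a * cpow q k) * (q / b * cpow q k)
                = al * q * cpow q (k + k))
    by (unfold X; rewrite cpow_add; field; auto).
  assert (Hal1 : 1 - al <> 0).
  { intros E; apply Hal. replace al with (1 - (1 - al)) by ring. rewrite E; ring. }
  set (K := qsgn q k * cpow q k * cpow (X * cpow q N) k / cpow (cpow q k) k
    * qpoch (al * q) q (k + k) * qpoch (/ cpow q N) q k
    / (qpoch q q k * qpoch (al * a) q k * qpoch (al * b) q k
       * qpoch (al * (q * cpow q N)) q k)).
  transitivity (K * sum_n (phi65_term X (q / a * cpow q k) (q / b * cpow q k)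
    (/ cpow q (N - k)) q) (N - k)).
  - rewrite <- Csum_mult_l. apply Csum_ext; intros m Hm.
    unfold phi65_term. rewrite EBC, EB, EC.
    replace (al * q * cpow q (k + k) / q) with (al * cpow q (k + k)) by (field; auto).
    replace (al * q * cpow q (k + k) / / cpow q (N - k))
      with (al * (q * cpow q N) * cpow q k).
    2:{ rewrite <- Ez. rewrite cpow_add.
        assert (H1 := cpow_nz q k Hq0). assert (H2 := cpow_nz q N Hq0).
        field. auto. }
    rewrite <- Ez.
    assert (V := very_well_poised_shift al k m).
    rewrite (qpoch_neg (k + m) k) by (auto; lia).
    replace (k + m - k)%nat with m by lia.
    rewrite !(qpoch_add (q / a)), !(qpoch_add (q / b)), !(qpoch_add (al * a)),
      !(qpoch_add (al * b)), !(qpoch_add (/ cpow q N)),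
      !(qpoch_add (al * (q * cpow q N))).
    assert (Hs : forall x : C, (forall n, qpoch x q n <> 0) ->
      qpoch x q k <> 0 /\ qpoch (x * cpow q k) q m <> 0).
    { intros x Hx; split; auto. now apply qpoch_shift_nz. }
    destruct (Hs _ Hala), (Hs _ Halb), (Hs _ Halc), (Hs _ Hqa), (Hs _ Hqb).
    (* The powers of [q^(k+m)] in the denominator of [(q^(-k-m))_k] lower the argument from [X q^N]
       to [X q^(N-k)], the [Y / D] of the 6phi5. *)
    assert (Z : cpow (X * cpow q N) (k + m) / cpow (cpow q (k + m)) k
      = cpow (X * cpow q N) k / cpow (cpow q k) k
        * cpow (X / (/ cpow q N * cpow q k)) m).
    { rewrite (cpow_add (X * cpow q N)), (cpow_add q k m), (cpow_mul (cpow q k)).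
      replace (X * cpow q N) with (cpow q k * (X / (/ cpow q N * cpow q k))).
      2:{ assert (H9 := cpow_nz q k Hq0). assert (H10 := cpow_nz q N Hq0).
          field; auto. }
      rewrite (cpow_mul _ _ m).
      assert (Sw : cpow (cpow q m) k = cpow (cpow q k) m).
      { clear. revert k; induction m as [|m IH]; intros k; simpl.
        - apply cpow_1.
        - rewrite cpow_mul, IH. reflexivity. }
      rewrite Sw.
      assert (H9 := cpow_nz _ k (cpow_nz q k Hq0)).
      assert (H10 := cpow_nz _ m (cpow_nz q k Hq0)).
      field. auto. }
    transitivity (
      ((1 - al * cpow q (2 * (k + m))) * qpoch al q (k + m)
          * qpoch (al * cpow q (k + m)) q k) / (1 - al)
      * (cpow (X * cpow q N) (k + m) / cpow (cpow q (k + m)) k)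
      * (qsgn q k * cpow q k * qpoch (/ cpow q N) q k
        / (qpoch q q k * qpoch (al * a) q k * qpoch (al * b) q k
           * qpoch (al * (q * cpow q N)) q k))
      * (qpoch (q / a * cpow q k) q m * qpoch (q / b * cpow q k) q m
         * qpoch (/ cpow q N * cpow q k) q m
         / (qpoch q q m * qpoch (al * a * cpow q k) q m
         * qpoch (al * b * cpow q k) q m * qpoch (al * (q * cpow q N) * cpow q k) q m))).
    { assert (H9 := cpow_nz _ k (cpow_nz q (k + m) Hq0)).
      assert (H10 := Hq (k + m)).
      fold X. cfield. auto 20. }
    rewrite V, Z. unfold K.
    assert (H9 := cpow_nz _ k (cpow_nz q k Hq0)).
    generalize (cpow (X / (/ cpow q N * cpow q k)) m). intros y.
    cfield. auto 20.
  - rewrite phi65_sum; rewrite ?EBC, ?EB, ?EC; auto.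
    2:{ now apply qpoch_shift_nz. }
    2:{ now apply qpoch_shift_nz. }
    2:{ intros n. replace (al * q * cpow q (k + k) * cpow q (N - k))
          with (al * (q * cpow q N) * cpow q k).
        - now apply qpoch_shift_nz.
        - replace N with (N - k + k)%nat at 1 by lia. rewrite !cpow_add. ring. }
    assert (Hs : forall x : C, qpoch x q N = qpoch x q k * qpoch (x * cpow q k) q (N - k))
      by (intros x; rewrite <- qpoch_add; f_equal; lia).
    (* Both sides are [(al q)_(N+k)]; the second factor on the right cancels the lower symbol in
       [K]. *)
    assert (E1 : qpoch (al * q) q (k + k) * qpoch (al * q * cpow q (k + k)) q (N - k)
      = qpoch (al * q) q N * qpoch (al * (q * cpow q N)) q k).
    { replace (al * (q * cpow q N)) with (al * q * cpow q N) by ring.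
      rewrite <- !qpoch_add. f_equal; lia. }
    assert (E2 : cpow (X * cpow q N) k = cpow X k * cpow (cpow q N) k) by apply cpow_mul.
    (* One sign comes from [(q^(-n))_k], the other from [(q^(-N))_k]; with [q^k] their product is
       [q^(k^2)], which cancels the remaining denominator. *)
    assert (E3 : qsgn q k * qsgn q k * cpow q k = cpow (cpow q k) k).
    { clear. induction k as [|k IH]; simpl; [ring|].
      rewrite cpow_mul, <- IH. ring. }
    assert (N1 := cpow_nz _ k (cpow_nz q k Hq0)).
    assert (N2 := cpow_nz _ k (cpow_nz q N Hq0)).
    assert (N3 := qpoch_shift_nz _ Hala k (N - k)).
    assert (N4 := qpoch_shift_nz _ Halb k (N - k)).
    unfold K. rewrite (qpoch_neg N k) by auto. rewrite E2, (Hs (al * a)), (Hs (al * b)).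
    unfold qbin.
    transitivity (qsgn q k * qsgn q k * cpow q k / cpow (cpow q k) k
      * (qpoch (al * q) q (k + k) * qpoch (al * q * cpow q (k + k)) q (N - k))
      * cpow X k * qpoch q q N * qpoch X q (N - k)
      / (qpoch q q k * qpoch q q (N - k) * qpoch (al * (q * cpow q N)) q k
         * (qpoch (al * a) q k * qpoch (al * a * cpow q k) q (N - k))
         * (qpoch (al * b) q k * qpoch (al * b * cpow q k) q (N - k)))).
    { cfield. auto 20. }
    rewrite E1, E3. cfield. auto 20.
Qed.

(** At [c = q^(N+1)] the infinite products of the prefactor combine into finite symbols, for
    instance [(al a c/q)_inf / (al a)_inf = 1/(al a)_N]. In this form no infinite product occurs. *)
Lemma terminating_case :
  u <> 0 -> v <> 0 ->
  (forall n, qpoch (be * ga * u * v) q n <> 0) ->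
  (forall n, qpoch be q n <> 0) -> (forall n, qpoch ga q n <> 0) ->
  (forall n, qpoch (al * be * a * b / q) q n <> 0) ->
  (forall n, qpoch (al * ga * a * b / q) q n <> 0) ->
  csum (lhs_term q al a b (q * cpow q N) be ga u v)
  = qpoch (al * q) q N * qpoch (al * be * a * b / q) q N * qpoch (al * ga * a * b / q) q N
    / (qpoch (al * a) q N * qpoch (al * b) q N * qpoch (be * ga * u * v) q N)
    * csum (rhs_phi_term q al a b (q * cpow q N) be ga u v).
Proof.
  intros Hu Hv Hw Hbe Hga HXbe HXga.
  set (X := al * a * b / q). set (w := be * ga * u * v).
  assert (HN := cpow_nz q N Hq0).
  assert (EN : q / (q * cpow q N) = / cpow q N) by (field; auto).
  assert (EX1 : al * be * a * b / q = X * be) by (unfold X; field; auto).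
  assert (EX2 : al * ga * a * b / q = X * ga) by (unfold X; field; auto).
  rewrite EX1 in *. rewrite EX2 in *. fold w in Hw.
  transitivity (qpoch (al * q) q N / (qpoch (al * a) q N * qpoch (al * b) q N)
    * (sears_poly (X * be) (X * ga) (X * / u) (X * / v) w N / qpoch w q N)).
  - rewrite <- (sears_poly_dilation X be ga (/ u) (/ v) w (be * u) (be * v)); auto.
    2:{ field; auto. }
    2:{ unfold w; field; auto. }
    2:{ unfold w; field; auto. }
    rewrite (csum_finite _ N).
    2:{ intros n Hn. unfold lhs_term. rewrite EN, (qpoch_neg_vanish N n) by auto.
        unfold Cdiv; ring. }
    unfold lhs_term.
    rewrite (Csum_ext _ (fun n => sum_n (fun k =>
      ((1 - al * cpow q (2 * n))
    * (qpoch al q n * qpoch (q / a) q n * qpoch (q / b) q n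
       * qpoch (/ cpow q N) q n)
    / ((1 - al) * (qpoch q q n * qpoch (al * a) q n
       * qpoch (al * b) q n * qpoch (al * (q * cpow q N)) q n))
    * cpow (al * a * b / q * cpow q N) n
    * (qpoch (/ cpow q n) q k * qpoch (al * cpow q n) q k * cpow q k
       / (qpoch q q k * qpoch (q / a) q k * qpoch (q / b) q k)))
      * (sears_poly be ga (/ u) (/ v) w k / qpoch w q k)) n)).
    + rewrite Csum_triangle, <- Csum_mult_l.
      apply Csum_ext; intros k Hk.
      rewrite (Csum_ext _ (fun m => (sears_poly be ga (/ u) (/ v) w k / qpoch w q k) *
        ((1 - al * cpow q (2 * (k + m)))
    * (qpoch al q (k + m) * qpoch (q / a) q (k + m) * qpoch (q / b) q (k + m)
       * qpoch (/ cpow q N) q (k + m))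
    / ((1 - al) * (qpoch q q (k + m) * qpoch (al * a) q (k + m)
       * qpoch (al * b) q (k + m) * qpoch (al * (q * cpow q N)) q (k + m)))
    * cpow (al * a * b / q * cpow q N) (k + m)
    * (qpoch (/ cpow q (k + m)) q k * qpoch (al * cpow q (k + m)) q k * cpow q k
       / (qpoch q q k * qpoch (q / a) q k * qpoch (q / b) q k))))).
      2:{ intros m Hm. cring. }
      rewrite Csum_mult_l, inner_phi65 by exact Hk. fold X. cring.
    + intros n Hn. rewrite EN, <- Csum_mult_l. apply Csum_ext; intros k Hk.
      rewrite <- (phi32_terminating be ga) by auto.
      replace (al * a * b * (q * cpow q N) / (q * q)) with (al * a * b / q * cpow q N)
        by (field; auto).
      fold w. etransitivity; [|apply Cmult_assoc]. f_equal. cfield. auto 10.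
  - unfold rhs_phi_term. fold w. rewrite EX1, EX2, EN.
    replace (al * a * b / (q * u)) with (X * / u) by (unfold X; field; auto).
    replace (al * a * b / (q * v)) with (X * / v) by (unfold X; field; auto).
    replace (be * ga * (q * cpow q N) * u * v / q) with (w * cpow q N)
      by (unfold w; field; auto).
    rewrite <- (phi32_terminating (X * be) (X * ga)) by auto.
    unfold phi32. assert (Hwn := Hw N). specialize (Hala N). specialize (Halb N).
    field. auto.
Qed.
End Terminating.
End Finite.

(** * Absolutely convergent power series *)

Open Scope R_scope.

Lemma Rsum_S (f : nat -> R) n : sum_n f (S n) = sum_n f n + f (S n) :> R.
Proof. exact (sum_Sn f n). Qed.

Lemma Rsum_shift (f : nat -> R) n :
  sum_n f (S n) = f 0%nat + sum_n (fun k => f (S k)) n :> R.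
Proof.
  induction n as [|n IH].
  - now rewrite Rsum_S, !sum_O.
  - rewrite Rsum_S, IH, Rsum_S. ring.
Qed.

Lemma Rsum_le (f g : nat -> R) n : (forall k, f k <= g k) -> sum_n f n <= sum_n g n.
Proof.
  intros H; induction n as [|n IH].
  - rewrite !sum_O; apply H.
  - rewrite !Rsum_S. apply Rplus_le_compat; auto.
Qed.

Lemma Rsum_mult_l (x : R) (f : nat -> R) n :
  sum_n (fun k => x * f k) n = x * sum_n f n :> R.
Proof. exact (sum_n_mult_l (K := R_Ring) x f n). Qed.

Lemma Rsum_plus (f g : nat -> R) n :
  sum_n (fun k => f k + g k) n = sum_n f n + sum_n g n :> R.
Proof. exact (sum_n_plus f g n). Qed.

Lemma Rsum_ge_0 (f : nat -> R) n : (forall k, 0 <= f k) -> 0 <= sum_n f n.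
Proof.
  intros H; induction n as [|n IH].
  - rewrite sum_O; apply H.
  - rewrite Rsum_S. specialize (H (S n)). lra.
Qed.

Lemma Rsum_term_le (f : nat -> R) n : (forall k, 0 <= f k) -> f n <= sum_n f n.
Proof.
  intros H; destruct n as [|n].
  - rewrite sum_O; lra.
  - rewrite Rsum_S. assert (H' := Rsum_ge_0 f n H). lra.
Qed.

Lemma Cmod_sum_le (f : nat -> C) n : Cmod (sum_n f n) <= sum_n (fun k => Cmod (f k)) n.
Proof.
  induction n as [|n IH].
  - rewrite !sum_O; apply Rle_refl.
  - rewrite Csum_S, Rsum_S.
    eapply Rle_trans; [apply Cmod_triangle|]. now apply Rplus_le_compat_r.
Qed.

Lemma Rsum_le_lim (f : nat -> R) l n :
  (forall k, 0 <= f k) -> is_series f l -> sum_n f n <= l.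
Proof.
  intros H Hl. apply (is_lim_seq_incr_compare (sum_n f) l Hl).
  intros k. rewrite Rsum_S. specialize (H (S k)). lra.
Qed.

Lemma Clim_Cmod (f : nat -> C) (l : C) :
  filterlim f eventually (locally l) <-> is_lim_seq (fun n => Cmod (f n - l)%C) 0.
Proof.
  split.
  - intros H. apply is_lim_seq_spec. intros eps.
    destruct (proj1 (filterlim_locally_ball_norm (K := C_AbsRing)
      (U := C_NormedModule) f l) H eps) as [N HN].
    exists N. intros n Hn. specialize (HN n Hn).
    rewrite Rminus_0_r, Rabs_pos_eq by apply Cmod_ge_0. exact HN.
  - intros H. apply (filterlim_locally_ball_norm (K := C_AbsRing)
      (U := C_NormedModule) f l). intros eps.
    apply is_lim_seq_spec in H. destruct (H eps) as [N HN].
    exists N. intros n Hn. specialize (HN n Hn).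
    rewrite Rminus_0_r, Rabs_pos_eq in HN by apply Cmod_ge_0. exact HN.
Qed.

Lemma Clim_le (f : nat -> C) (l : C) K N :
  filterlim f eventually (locally l) -> (forall n, (N <= n)%nat -> Cmod (f n) <= K) ->
  Cmod l <= K.
Proof.
  intros H HK. apply Clim_Cmod in H.
  apply Rnot_lt_le; intros Hlt.
  apply is_lim_seq_spec in H.
  destruct (H (mkposreal (Cmod l - K) (proj2 (Rlt_0_minus _ _) Hlt))) as [M HM].
  specialize (HM (N + M)%nat ltac:(lia)). specialize (HK (N + M)%nat ltac:(lia)).
  simpl in HM. rewrite Rminus_0_r, Rabs_pos_eq in HM by apply Cmod_ge_0.
  assert (T := Cmod_triangle (f (N + M)%nat) (- (f (N + M)%nat - l))%C).
  replace (f (N + M)%nat + - (f (N + M)%nat - l))%C with l in T by ring.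
  rewrite Cmod_opp in T. lra.
Qed.

Lemma Cseries_le (f : nat -> C) (l : C) K N :
  is_series f l -> (forall n, (N <= n)%nat -> Cmod (sum_n f n) <= K) -> Cmod l <= K.
Proof. exact (Clim_le (sum_n f) l K N). Qed.

Lemma Cseries_Cmod (f : nat -> C) (l : C) :
  is_series f l <-> is_lim_seq (fun n => Cmod (sum_n f n - l)%C) 0.
Proof. exact (Clim_Cmod (sum_n f) l). Qed.

Lemma Cseries_unique (f : nat -> C) (l l' : C) : is_series f l -> is_series f l' -> l = l'.
Proof. intros H H'. now rewrite <- (csum_unique f l H), <- (csum_unique f l' H'). Qed.

Lemma Cseries_abs (f : nat -> C) (g : nat -> R) :
  (forall n, Cmod (f n) <= g n) -> ex_series g -> is_series f (csum f).
Proof.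
  intros H Hg. destruct (ex_series_le (K := C_AbsRing) (V := C_CompleteNormedModule) f g H Hg)
    as [l Hl].
  now rewrite (csum_unique f l Hl).
Qed.

Lemma Cseries_scal (x : C) (f : nat -> C) (l : C) :
  is_series f l -> is_series (fun n => x * f n)%C (x * l)%C.
Proof. exact (is_series_scal (K := C_AbsRing) (V := C_NormedModule) x f l). Qed.

Lemma Cseries_plus (f g : nat -> C) (l m : C) :
  is_series f l -> is_series g m -> is_series (fun n => f n + g n)%C (l + m)%C.
Proof. exact (is_series_plus (K := C_AbsRing) (V := C_NormedModule) f g l m). Qed.

Lemma Cseries_ext (f g : nat -> C) (l : C) :
  (forall n, f n = g n) -> is_series f l -> is_series g l.
Proof. exact (is_series_ext (K := C_AbsRing) (V := C_NormedModule) f g l). Qed.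

(** Dominated convergence: beyond [N] the majorant leaves at most [L - sum_n M N], uniformly in [i],
    and the finitely many earlier terms tend to 0. *)
Lemma tannery (D : nat -> nat -> C) (M : nat -> R) (S : nat -> C) :
  (forall i n, Cmod (D i n) <= M n) -> ex_series M ->
  (forall n, is_lim_seq (fun i => Cmod (D i n)) 0) ->
  (forall i, is_series (D i) (S i)) -> is_lim_seq (fun i => Cmod (S i)) 0.
Proof.
  intros HM [L HL] HD HS.
  assert (HM0 : forall n, 0 <= M n)
    by (intros n; eapply Rle_trans; [apply Cmod_ge_0|apply (HM 0%nat n)]).
  assert (HB : forall N i, Cmod (S i) <= sum_n (fun n => Cmod (D i n)) N + (L - sum_n M N)).
  { intros N i. apply (Cseries_le _ _ _ N (HS i)). intros n Hn.
    apply Rle_trans with (sum_n (fun n => Cmod (D i n)) N + (sum_n M n - sum_n M N)).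
    - induction Hn as [|n Hn IH].
      + eapply Rle_trans; [apply Cmod_sum_le|]. rewrite Rminus_diag, Rplus_0_r; apply Rle_refl.
      + rewrite Csum_S, Rsum_S. eapply Rle_trans; [apply Cmod_triangle|].
        specialize (HM i (Datatypes.S n)). lra.
    - assert (H := Rsum_le_lim M L n HM0 HL). lra. }
  assert (HF : forall N, is_lim_seq (fun i => sum_n (fun n => Cmod (D i n)) N) 0).
  { induction N as [|N IH].
    - eapply is_lim_seq_ext; [|apply (HD 0%nat)]. intros i; now rewrite sum_O.
    - eapply is_lim_seq_ext; [intros i; symmetry; apply Rsum_S|].
      rewrite <- (Rplus_0_r 0). apply is_lim_seq_plus'; auto. }
  apply is_lim_seq_spec. intros eps.
  apply (is_lim_seq_spec (sum_n M) L) in HL. destruct (HL (pos_div_2 eps)) as [N HN].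
  specialize (HN N (Nat.le_refl N)). simpl in HN.
  specialize (HF N). apply is_lim_seq_spec in HF.
  destruct (HF (pos_div_2 eps)) as [I HI]. exists I. intros i Hi. specialize (HI i Hi).
  simpl in HI. rewrite Rminus_0_r in *. rewrite Rabs_pos_eq by apply Cmod_ge_0.
  specialize (HB N i). apply Rabs_def2 in HN. apply Rabs_def2 in HI. lra.
Qed.

(* Absolute convergence up to the boundary of the disc makes this class stable
   under norm-summable series and gives an identity theorem without Cauchy's
   formula. *)
Definition wiener (rho M : R) (f : C -> C) : Prop :=
  exists a : nat -> C,
    (forall n, sum_n (fun i => Cmod (a i) * rho ^ i) n <= M) /\
    forall z, Cmod z <= rho -> is_series (fun i => a i * cpow z i)%C (f z).

Lemma Cmod_cpow (z : C) n : Cmod (cpow z n) = Cmod z ^ n.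
Proof.
  induction n as [|n IH]; simpl; [apply Cmod_1|].
  now rewrite Cmod_mult, IH.
Qed.

Section Wiener.
Context (rho : R) (Hrho : 0 < rho).

Lemma wiener_ext M M' f g :
  M <= M' -> (forall z, Cmod z <= rho -> f z = g z) -> wiener rho M f -> wiener rho M' g.
Proof.
  intros HM H [a [Ha Hf]]. exists a; split.
  - intros n; eapply Rle_trans; [apply Ha|exact HM].
  - intros z Hz. rewrite <- H; auto.
Qed.

Lemma wiener_partial_le (a : nat -> C) z n :
  Cmod z <= rho ->
  Cmod (sum_n (fun i => a i * cpow z i)%C n) <= sum_n (fun i => Cmod (a i) * rho ^ i) n.
Proof.
  intros Hz. eapply Rle_trans; [apply Cmod_sum_le|]. apply Rsum_le; intros k.
  rewrite Cmod_mult, Cmod_cpow. apply Rmult_le_compat_l; [apply Cmod_ge_0|].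
  apply pow_incr. split; [apply Cmod_ge_0|exact Hz].
Qed.

Lemma wiener_le M f z : wiener rho M f -> Cmod z <= rho -> Cmod (f z) <= M.
Proof.
  intros [a [Ha Hf]] Hz. apply (Cseries_le _ _ _ 0 (Hf z Hz)). intros n _.
  eapply Rle_trans; [apply wiener_partial_le, Hz|apply Ha].
Qed.

Lemma wiener_ge_0 M f : wiener rho M f -> 0 <= M.
Proof.
  intros H. apply Rle_trans with (Cmod (f 0)); [apply Cmod_ge_0|].
  apply (wiener_le M f 0 H). rewrite Cmod_0; lra.
Qed.

Lemma wiener_const (x : C) : wiener rho (Cmod x) (fun _ => x).
Proof.
  exists (fun i => match i with O => x | S _ => RtoC 0 end); split.
  - intros n; induction n as [|n IH].
    + rewrite sum_O; simpl; lra.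
    + rewrite Rsum_S, Cmod_0. lra.
  - intros z _.
    refine (eq_ind _ (is_series _) (Cseries_finite _ 0 _) x _).
    + intros [|n] Hn; [lia|ring].
    + rewrite Csum_O; apply Cmult_1_r.
Qed.

Lemma wiener_plus M N f g :
  wiener rho M f -> wiener rho N g -> wiener rho (M + N) (fun z => f z + g z)%C.
Proof.
  intros [a [Ha Hf]] [b [Hb Hg]]. exists (fun i => a i + b i)%C; split.
  - intros n. eapply Rle_trans; [|apply Rplus_le_compat; [apply (Ha n)|apply (Hb n)]].
    rewrite <- Rsum_plus. apply Rsum_le; intros k.
    rewrite <- Rmult_plus_distr_r. apply Rmult_le_compat_r; [apply pow_le; lra|].
    apply Cmod_triangle.
  - intros z Hz. eapply Cseries_ext; [|apply Cseries_plus; [apply Hf|apply Hg]; exact Hz].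
    intros n; simpl; ring.
Qed.

Lemma wiener_scal (x : C) M f : wiener rho M f -> wiener rho (Cmod x * M) (fun z => x * f z)%C.
Proof.
  intros [a [Ha Hf]]. exists (fun i => x * a i)%C; split.
  - intros n. apply Rle_trans with (Cmod x * sum_n (fun i => Cmod (a i) * rho ^ i) n).
    + rewrite <- Rsum_mult_l. apply Rsum_le; intros k. rewrite Cmod_mult. lra.
    + apply Rmult_le_compat_l; [apply Cmod_ge_0|apply Ha].
  - intros z Hz. eapply Cseries_ext; [|apply Cseries_scal, (Hf z Hz)].
    intros n; simpl; ring.
Qed.

Lemma wiener_mul_id M f : wiener rho M f -> wiener rho (rho * M) (fun z => z * f z)%C.
Proof.
  intros [a [Ha Hf]]. exists (fun i => match i with O => RtoC 0 | S j => a j end); split.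
  - intros n. destruct n as [|n].
    + rewrite sum_O, Cmod_0, Rmult_0_l. apply Rmult_le_pos; [lra|].
      eapply Rle_trans; [|apply (Ha 0%nat)]. apply Rsum_ge_0.
      intros k; apply Rmult_le_pos; [apply Cmod_ge_0|apply pow_le; lra].
    + apply Rle_trans with (rho * sum_n (fun i => Cmod (a i) * rho ^ i) n).
      * rewrite <- Rsum_mult_l, Rsum_shift, Cmod_0, Rmult_0_l, Rplus_0_l.
        apply Rsum_le; intros k; simpl; lra.
      * apply Rmult_le_compat_l; [lra|apply Ha].
  - intros z Hz.
    apply (is_series_decr_1 (K := C_AbsRing) (V := C_NormedModule)).
    refine (eq_ind (z * f z)%C (is_series _) _ _ _).
    + eapply Cseries_ext; [|apply (Cseries_scal z _ _ (Hf z Hz))].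
      intros n; simpl; ring.
    + change (z * f z = z * f z + - (0 * cpow z 0))%C. ring.
Qed.

(** The polynomials in [c] that occur are products of affine factors, so this replaces a general
    Cauchy product of power series. *)
Lemma wiener_mul_affine (x y : C) M f :
  wiener rho M f ->
  wiener rho ((Cmod x + Cmod y * rho) * M) (fun z => (x + y * z) * f z)%C.
Proof.
  intros H.
  apply wiener_ext with (Cmod x * M + Cmod y * (rho * M))
    (fun z => x * f z + y * (z * f z))%C.
  - lra.
  - intros z _; ring.
  - apply wiener_plus; apply wiener_scal; [exact H|now apply wiener_mul_id].
Qed.

(** Coefficientwise, [|A n i| <= M n / rho^i] gives convergence over [n]. The norm bound follows by
    switching finite sums and then letting [N] grow. *)
Lemma wiener_sum (M : nat -> R) (L : R) (f : nat -> C -> C) (g : C -> C) :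
  (forall n, wiener rho (M n) (f n)) -> is_series M L ->
  (forall z, Cmod z <= rho -> is_series (fun n => f n z) (g z)) -> wiener rho L g.
Proof.
  intros Hf HM Hg.
  set (A n := proj1_sig (constructive_indefinite_description _ (Hf n))).
  assert (HA : forall n i, sum_n (fun i => Cmod (A n i) * rho ^ i) i <= M n).
  { intros n i. unfold A. destruct (constructive_indefinite_description _ (Hf n))
      as [a [Ha Hs]]. apply Ha. }
  assert (HS : forall n z, Cmod z <= rho -> is_series (fun i => A n i * cpow z i)%C (f n z)).
  { intros n z. unfold A. destruct (constructive_indefinite_description _ (Hf n))
      as [a [Ha Hs]]. apply Hs. }
  clearbody A.
  assert (HM0 : forall n, 0 <= M n) by (intros n; apply (wiener_ge_0 _ _ (Hf n))).
  assert (HP : forall i, 0 < rho ^ i) by (intros; now apply pow_lt).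
  assert (Hterm : forall i n, Cmod (A n i) <= / rho ^ i * M n).
  { intros i n. apply Rmult_le_reg_r with (rho ^ i); [apply HP|].
    replace (/ rho ^ i * M n * rho ^ i) with (M n) by (field; apply Rgt_not_eq, HP).
    eapply Rle_trans; [|apply (HA n i)].
    apply (Rsum_term_le (fun i => Cmod (A n i) * rho ^ i)).
    intros k; apply Rmult_le_pos; [apply Cmod_ge_0|apply Rlt_le, HP]. }
  assert (Hb : forall i, is_series (fun n => A n i) (csum (fun n => A n i))).
  { intros i. apply Cseries_abs with (1 := Hterm i).
    apply (ex_series_scal (K := R_AbsRing) (V := R_NormedModule)). now exists L. }
  exists (fun i => csum (fun n => A n i)); split.
  - intros I.
    assert (Hlim : is_lim_seq
      (fun N => sum_n (fun i => Cmod (sum_n (fun n => A n i) N) * rho ^ i) I)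
      (sum_n (fun i => Cmod (csum (fun n => A n i)) * rho ^ i) I)).
    { assert (H1 : forall i, is_lim_seq
        (fun N => Cmod (sum_n (fun n => A n i) N) * rho ^ i)
        (Cmod (csum (fun n => A n i)) * rho ^ i)).
      { intros i. apply (is_lim_seq_scal_r _ (rho ^ i) (Cmod (csum (fun n => A n i)))).
        apply (filterlim_comp _ _ _ _ _ _ _ _ (Hb i)).
        exact (filterlim_norm (K := C_AbsRing) (V := C_NormedModule) _). }
      induction I as [|I IH].
      - rewrite sum_O. eapply is_lim_seq_ext; [|apply H1].
        intros N; now rewrite sum_O.
      - rewrite Rsum_S. eapply is_lim_seq_ext; [intros N; symmetry; apply Rsum_S|].
        now apply is_lim_seq_plus'. }
    refine (is_lim_seq_le _ (fun _ => L) _ _ _ Hlim (is_lim_seq_const L)).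
    intros N. apply Rle_trans with (sum_n M N); [|now apply Rsum_le_lim].
    apply Rle_trans with
      (sum_n (fun i => sum_n (fun n => Cmod (A n i) * rho ^ i) N) I).
    + apply Rsum_le; intros i.
      apply Rle_trans with (rho ^ i * sum_n (fun n => Cmod (A n i)) N).
      * rewrite Rmult_comm. apply Rmult_le_compat_l; [apply Rlt_le, HP|apply Cmod_sum_le].
      * rewrite <- Rsum_mult_l. apply Rsum_le; intros n. lra.
    + rewrite sum_n_switch. apply Rsum_le; intros n. apply HA.
  - intros z Hz. apply Cseries_Cmod.
    (* The majorant is [2 M n]: one [M n] for the partial sum of the power series of [f n], one for
       its value at [z]. *)
    apply (tannery (fun I n => sum_n (fun i => A n i * cpow z i)%C I - f n z)%C
      (fun n => 2 * M n)).
    + intros I n. unfold Cminus. eapply Rle_trans; [apply Cmod_triangle|].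
      rewrite Cmod_opp. assert (H1 := wiener_le _ _ z (Hf n) Hz).
      assert (H2 := Rle_trans _ _ _ (wiener_partial_le (A n) z I Hz) (HA n I)).
      lra.
    + apply (ex_series_scal (K := R_AbsRing) (V := R_NormedModule)). now exists L.
    + intros n. apply Cseries_Cmod, (HS n z Hz).
    + intros I. unfold Cminus. apply Cseries_plus.
      * induction I as [|I IH].
        -- rewrite sum_O. eapply Cseries_ext.
           2:{ rewrite Cmult_comm. apply Cseries_scal, Hb. }
           intros n; rewrite Csum_O; ring.
        -- rewrite Csum_S. eapply Cseries_ext.
           2:{ apply Cseries_plus; [exact IH|].
               rewrite Cmult_comm. apply Cseries_scal, Hb. }
           intros n; rewrite Csum_S; ring.
      * replace (- g z)%C with (- (1) * g z)%C by ring.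
        eapply Cseries_ext; [|apply Cseries_scal, (Hg z Hz)].
        intros n; simpl; ring.
Qed.

Lemma wiener_csum (M : nat -> R) (f : nat -> C -> C) :
  (forall n, wiener rho (M n) (f n)) -> ex_series M ->
  exists L, wiener rho L (fun z => csum (fun n => f n z)).
Proof.
  intros Hf [L HL]. exists L. apply wiener_sum with (1 := Hf) (2 := HL).
  intros z Hz. apply Cseries_abs with M; [|now exists L].
  intros n. now apply wiener_le.
Qed.

(** If the coefficients below [m] vanish, a zero at [x] gives [|a m| |x|^m <= (|x|/rho)^(m+1) M],
    since the higher terms all carry that power. Hence [|a m| <= |x| M / rho^(m+1)], which tends to
    0 along the sequence. *)
Lemma wiener_zero M f (x : nat -> C) :
  wiener rho M f -> (forall n, x n <> RtoC 0) -> (forall n, Cmod (x n) <= rho) ->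
  (forall n, f (x n) = RtoC 0) -> is_lim_seq (fun n => Cmod (x n)) 0 ->
  forall z, Cmod z <= rho -> f z = RtoC 0.
Proof.
  intros H Hx0 Hxr Hfx Hlim. assert (HM := wiener_ge_0 _ _ H).
  destruct H as [a [Ha Hf]].
  assert (Hzero : forall m, a m = RtoC 0).
  { intros m; induction m as [m IH] using (well_founded_induction Wf_nat.lt_wf).
    apply Cmod_eq_0. apply Rle_antisym; [|apply Cmod_ge_0].
    apply Rnot_lt_le; intros Hpos.
    assert (Hrm : 0 < rho ^ m) by now apply pow_lt.
    assert (K : forall n, Cmod (a m) <= Cmod (x n) * (M / rho ^ m / rho)).
    { intros n. assert (Hxp : 0 < Cmod (x n)) by (apply Cmod_gt_0, Hx0).
      set (t := Cmod (x n) / rho).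
      assert (Ht0 : 0 < t) by (apply Rdiv_lt_0_compat; lra).
      assert (Ht1 : t <= 1).
      { unfold t. apply Rmult_le_reg_r with rho; [lra|].
        unfold Rdiv. rewrite Rmult_assoc, Rinv_l, Rmult_1_r, Rmult_1_l; [apply Hxr|lra]. }
      assert (Htr : t * rho = Cmod (x n)) by (unfold t; field; lra).
      (* The [m]-th term alone, written as a sequence, so that it can be subtracted from the series
         term by term. *)
      set (d i := if Nat.eq_dec i m then (a m * cpow (x n) m)%C else RtoC 0 : C).
      assert (Hterm : forall i,
        Cmod (a i * cpow (x n) i - d i)%C <= t ^ S m * (Cmod (a i) * rho ^ i)).
      { intros i. assert (P : (0 <= t ^ S m * (Cmod (a i) * rho ^ i))%R).
        { apply Rmult_le_pos; [apply pow_le; lra|].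
          apply Rmult_le_pos; [apply Cmod_ge_0|apply pow_le; lra]. }
        unfold d. destruct (Nat.eq_dec i m) as [->|Hne].
        - unfold Cminus. rewrite Cplus_opp_r, Cmod_0. exact P.
        - destruct (Nat.lt_ge_cases i m) as [Hi|Hi].
          + rewrite (IH i Hi). replace (0 * cpow (x n) i - 0)%C with (RtoC 0) by ring.
            rewrite Cmod_0. rewrite (IH i Hi), Cmod_0 in P. exact P.
          + replace (a i * cpow (x n) i - 0)%C with (a i * cpow (x n) i)%C by ring.
            rewrite Cmod_mult, Cmod_cpow, <- Htr, Rpow_mult_distr.
            replace (t ^ S m * (Cmod (a i) * rho ^ i))
              with (Cmod (a i) * (t ^ S m * rho ^ i)) by ring.
            apply Rmult_le_compat_l; [apply Cmod_ge_0|].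
            apply Rmult_le_compat_r; [apply pow_le; lra|].
            replace i with (S m + (i - S m))%nat by lia. rewrite pow_add.
            rewrite <- (Rmult_1_r (t ^ S m)) at 2.
            apply Rmult_le_compat_l; [apply pow_le; lra|].
            rewrite <- (pow1 (i - S m)). apply pow_incr; lra. }
      assert (Hd : forall k, (m <= k)%nat -> sum_n d k = (a m * cpow (x n) m)%C).
      { assert (Hd0 : forall k, (k < m)%nat -> sum_n d k = RtoC 0).
        { intros k; induction k as [|k IHk]; intros Hk.
          - rewrite sum_O. unfold d. destruct (Nat.eq_dec 0 m); [lia|reflexivity].
          - rewrite Csum_S, IHk by lia. unfold d.
            destruct (Nat.eq_dec (S k) m); [lia|]. apply Cplus_0_r. }
        intros k Hk; induction Hk as [|k Hk IHk].
        - destruct m as [|m].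
          + rewrite sum_O. unfold d. now destruct (Nat.eq_dec 0 0).
          + rewrite Csum_S, Hd0 by lia. unfold d.
            destruct (Nat.eq_dec (S m) (S m)); [apply Cplus_0_l|lia].
        - rewrite Csum_S, IHk. unfold d.
          destruct (Nat.eq_dec (S k) m); [lia|]. apply Cplus_0_r. }
      assert (Hser := Hf (x n) (Hxr n)). rewrite Hfx in Hser.
      assert (B : Cmod (a m * cpow (x n) m)%C <= t ^ S m * M).
      { rewrite <- Cmod_opp.
        assert (Hlim' : filterlim
          (fun k => sum_n (fun i => a i * cpow (x n) i)%C k - a m * cpow (x n) m)%C
          eventually (locally (- (a m * cpow (x n) m))%C)).
        { apply Clim_Cmod. apply Cseries_Cmod in Hser.
          eapply is_lim_seq_ext; [|exact Hser]. intros k; simpl. f_equal. ring. }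
        apply (Clim_le _ _ _ m Hlim'). intros k Hk. rewrite <- (Hd k Hk).
        replace (sum_n (fun i => a i * cpow (x n) i)%C k - sum_n d k)%C
          with (sum_n (fun i => a i * cpow (x n) i - d i)%C k).
        2:{ clear. induction k as [|k IHk]; [now rewrite !sum_O|].
            rewrite !Csum_S, IHk. cring. }
        eapply Rle_trans; [apply Cmod_sum_le|].
        eapply Rle_trans; [apply Rsum_le, Hterm|].
        rewrite Rsum_mult_l. apply Rmult_le_compat_l; [apply pow_le; lra|apply Ha]. }
      rewrite Cmod_mult, Cmod_cpow in B.
      assert (Hxm : 0 < Cmod (x n) ^ m) by now apply pow_lt.
      apply Rmult_le_reg_r with (Cmod (x n) ^ m); [exact Hxm|].
      eapply Rle_trans; [exact B|]. simpl.
      rewrite <- Htr, Rpow_mult_distr. apply Req_le. field. split; lra. }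
    assert (Hl : is_lim_seq (fun n => Cmod (x n) * (M / rho ^ m / rho)) 0).
    { rewrite <- (Rmult_0_l (M / rho ^ m / rho)).
      apply (is_lim_seq_scal_r _ (M / rho ^ m / rho) 0 Hlim). }
    assert (Hle := is_lim_seq_le _ _ (Cmod (a m)) 0 K (is_lim_seq_const _) Hl).
    simpl in Hle. lra. }
  intros z Hz. apply (Cseries_unique (fun i => a i * cpow z i)%C); [now apply Hf|].
  refine (eq_ind _ (is_series _) (Cseries_finite _ 0 _) (RtoC 0) _).
  - intros n _. rewrite Hzero; ring.
  - rewrite Csum_O, Hzero; apply Cmult_0_l.
Qed.
End Wiener.

(** * Infinite q-products *)

Lemma exp_monotone x y : x <= y -> exp x <= exp y.
Proof.
  intros [H| ->]; [|apply Rle_refl]. now apply Rlt_le, exp_increasing.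
Qed.

(** The common majorant of q-shifted factorials, of their Wiener norms and, with [K = 2|x|], of
    their reciprocals for small [x]. *)
Fixpoint rprod (K r : R) (n : nat) : R :=
  match n with O => 1 | S m => rprod K r m * (1 + K * r ^ m) end.

Lemma rprod_ge_1 K r n : 0 <= K -> 0 <= r -> 1 <= rprod K r n.
Proof.
  intros HK Hr; induction n as [|n IH]; simpl; [lra|].
  assert (H := Rmult_le_pos _ _ HK (pow_le r n Hr)).
  assert (H' := Rmult_le_compat 1 (rprod K r n) 1 (1 + K * r ^ n)). lra.
Qed.

Lemma rprod_le_exp K r n : 0 <= K -> 0 <= r < 1 -> rprod K r n <= exp (K / (1 - r)).
Proof.
  intros HK Hr.
  (* Keeping the partial geometric sum in the exponent makes the bound inductive, through
     [1 + t <= exp t]. *)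
  apply Rle_trans with (exp (K / (1 - r) * (1 - r ^ n))).
  - induction n as [|n IH]; simpl.
    + rewrite Rminus_diag, Rmult_0_r, exp_0. lra.
    + replace (K / (1 - r) * (1 - r * r ^ n))
        with (K / (1 - r) * (1 - r ^ n) + K * r ^ n) by (field; lra).
      rewrite exp_plus.
      assert (H := Rmult_le_pos _ _ HK (pow_le r n (proj1 Hr))).
      apply Rmult_le_compat; [|lra|exact IH|apply exp_ineq1_le].
      apply Rle_trans with 1; [lra|apply rprod_ge_1; lra].
  - assert (H := pow_le r n (proj1 Hr)).
    assert (H1 : 0 <= K / (1 - r)) by (apply Rdiv_le_0_compat; lra).
    apply exp_monotone.
    rewrite <- (Rmult_1_r (K / (1 - r))) at 2. apply Rmult_le_compat_l; lra.
Qed.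

Lemma qpoch_le_rprod (x q : C) K n : Cmod x <= K -> Cmod (qpoch x q n) <= rprod K (Cmod q) n.
Proof.
  intros HK; induction n as [|n IH]; simpl; [rewrite Cmod_1; lra|].
  rewrite Cmod_mult. apply Rmult_le_compat; try apply Cmod_ge_0; [exact IH|].
  unfold Cminus. eapply Rle_trans; [apply Cmod_triangle|].
  rewrite Cmod_1, Cmod_opp, Cmod_mult, Cmod_cpow.
  apply Rplus_le_compat_l, Rmult_le_compat_r; [apply pow_le, Cmod_ge_0|exact HK].
Qed.

Section Products.
Context (q : C) (Hq : 0 < Cmod q < 1).

Lemma Cmod_q_pow_lim : is_lim_seq (fun n => Cmod q ^ n) 0.
Proof. apply is_lim_seq_geom. rewrite Rabs_pos_eq; lra. Qed.

Lemma qpoch_bounded (x : C) n : Cmod (qpoch x q n) <= exp (Cmod x / (1 - Cmod q)).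
Proof.
  eapply Rle_trans; [apply qpoch_le_rprod, Rle_refl|].
  apply rprod_le_exp; [apply Cmod_ge_0|lra].
Qed.

Lemma geom_series_scal (K : R) : is_series (fun n => K * Cmod q ^ n) (K * / (1 - Cmod q)).
Proof.
  apply (is_series_scal (K := R_AbsRing) (V := R_NormedModule)).
  apply is_series_geom. rewrite Rabs_pos_eq; lra.
Qed.

(** Telescoping of [(x)_n - (x)_(n+1) = (x)_n x q^n]. Besides convergence of the product, this
    presents it as a series of polynomials in [x], the form that [wiener_qpinf] uses. *)
Lemma qpinf_series (x : C) :
  is_series (fun n => qpoch x q n * (x * cpow q n))%C (1 - qpinf x q)%C
  /\ filterlim (qpoch x q) eventually (locally (qpinf x q)).
Proof.
  set (f n := (qpoch x q n * (x * cpow q n))%C).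
  assert (Hf : is_series f (csum f)).
  { apply Cseries_abs with
      (fun n => exp (Cmod x / (1 - Cmod q)) * Cmod x * Cmod q ^ n).
    - intros n. unfold f. rewrite !Cmod_mult, Cmod_cpow, Rmult_assoc.
      apply Rmult_le_compat_r; [|apply qpoch_bounded].
      apply Rmult_le_pos; [apply Cmod_ge_0|apply pow_le, Cmod_ge_0].
    - eexists; apply geom_series_scal. }
  assert (Ht : forall n, qpoch x q (S n) = (1 - sum_n f n)%C).
  { intros n; induction n as [|n IH].
    - rewrite Csum_O. unfold f; simpl; ring.
    - rewrite Csum_S. change (qpoch x q (S (S n)))
        with (qpoch x q (S n) * (1 - x * cpow q (S n)))%C.
      change (f (S n)) with (qpoch x q (S n) * (x * cpow q (S n)))%C.
      replace (sum_n f n : C) with (1 - qpoch x q (S n))%C by (rewrite IH; cring).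
      cring. }
  assert (Hl : filterlim (qpoch x q) eventually (locally (1 - csum f)%C)).
  { apply Clim_Cmod. apply is_lim_seq_incr_1. apply Cseries_Cmod in Hf.
    eapply is_lim_seq_ext; [|exact Hf]. intros n; simpl.
    change (qpoch x q n * (1 - x * cpow q n))%C with (qpoch x q (S n)). rewrite Ht.
    rewrite <- Cmod_opp. f_equal. ring. }
  assert (E : qpinf x q = (1 - csum f)%C).
  { unfold qpinf, climit.
    assert (H := epsilon_spec (inhabits (RtoC 0)) _ (ex_intro
      (fun l => filterlim (qpoch x q) eventually (locally l)) _ Hl)).
    exact (filterlim_locally_unique (V := C_NormedModule) _ _ _ H Hl). }
  rewrite E. split; [|exact Hl].
  replace (1 - (1 - csum f))%C with (csum f) by ring. exact Hf.
Qed.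

Lemma qpinf_split (x : C) n : qpinf x q = (qpoch x q n * qpinf (x * cpow q n) q)%C.
Proof.
  assert (H1 := proj2 (qpinf_series x)).
  assert (H2 := proj2 (qpinf_series (x * cpow q n)%C)).
  apply Clim_Cmod in H1. apply Clim_Cmod in H2.
  apply (is_lim_seq_incr_n _ n) in H1.
  apply (is_lim_seq_scal_l _ (Cmod (qpoch x q n)) 0) in H2.
  simpl in H2. rewrite Rmult_0_r in H2.
  assert (H : filterlim (fun k => qpoch x q (n + k)) eventually
    (locally (qpoch x q n * qpinf (x * cpow q n) q)%C)).
  { apply Clim_Cmod. eapply is_lim_seq_ext; [|exact H2]. intros k; simpl.
    rewrite <- Cmod_mult, qpoch_add. f_equal. ring. }
  refine (filterlim_locally_unique (V := C_NormedModule) _ _ _ _ H).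
  apply (Clim_Cmod (fun k => qpoch x q (n + k))).
  eapply is_lim_seq_ext; [|exact H1]. intros k; simpl. now rewrite Nat.add_comm.
Qed.

Lemma qpoch_nz_of_small (x : C) : Cmod x < 1 -> forall n, qpoch x q n <> 0%C.
Proof.
  intros Hx n; induction n as [|n IH]; simpl; [apply C1_nz|].
  apply Cmult_neq_0; [exact IH|]. intros E.
  assert (E' : (x * cpow q n)%C = 1%C).
  { replace (x * cpow q n)%C with (1 - (1 - x * cpow q n))%C by ring. rewrite E; ring. }
  apply (f_equal Cmod) in E'. rewrite Cmod_mult, Cmod_cpow, Cmod_1 in E'.
  assert (H1 := pow_le (Cmod q) n (Cmod_ge_0 q)).
  assert (H2 : Cmod q ^ n <= 1) by (rewrite <- (pow1 n); apply pow_incr; lra).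
  assert (H3 := Cmod_ge_0 x). nra.
Qed.

(* [(1 - t)(1 + 2 t) >= 1] for [0 <= t <= 1/2]. *)
Lemma qpoch_lower_small (x : C) n :
  Cmod x <= / 2 -> 1 <= Cmod (qpoch x q n) * rprod (2 * Cmod x) (Cmod q) n.
Proof.
  intros Hx; induction n as [|n IH]; simpl; [rewrite Cmod_1; lra|].
  rewrite Cmod_mult.
  assert (H1 := pow_le (Cmod q) n (Cmod_ge_0 q)).
  assert (H2 : Cmod q ^ n <= 1) by (rewrite <- (pow1 n); apply pow_incr; lra).
  assert (H3 := Cmod_ge_0 x).
  assert (Ht : 1 - Cmod x * Cmod q ^ n <= Cmod (1 - x * cpow q n)%C).
  { assert (T := Cmod_triangle (1 - x * cpow q n)%C (x * cpow q n)%C).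
    replace (1 - x * cpow q n + x * cpow q n)%C with (RtoC 1) in T by ring.
    rewrite Cmod_1, Cmod_mult, Cmod_cpow in T. lra. }
  set (t := Cmod x * Cmod q ^ n) in *.
  assert (Ht0 : 0 <= t) by (apply Rmult_le_pos; lra).
  assert (Ht1 : t <= / 2) by (unfold t; nra).
  replace (2 * Cmod x * Cmod q ^ n) with (2 * t) by (unfold t; ring).
  set (y := Cmod (1 - x * cpow q n)%C) in *.
  set (z := Cmod (qpoch x q n) * rprod (2 * Cmod x) (Cmod q) n) in *.
  replace (Cmod (qpoch x q n) * y * (rprod (2 * Cmod x) (Cmod q) n * (1 + 2 * t)))
    with (z * (y * (1 + 2 * t))) by (unfold z; ring).
  assert (1 <= y * (1 + 2 * t)) by nra. nra.
Qed.

(** Choose [N] with [|x q^N| <= 1/2]. For [n >= N] the remaining factors are controlled by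
    [qpoch_lower_small]; for [n <= N], [(x)_n] is [(x)_N] divided by a bounded symbol. *)
Lemma qpoch_lower (x : C) :
  (forall n, qpoch x q n <> 0%C) ->
  exists d, 0 < d /\ forall n, d <= Cmod (qpoch x q n).
Proof.
  intros Hx.
  assert (HN : exists N, Cmod (x * cpow q N)%C <= / 2).
  { assert (H := is_lim_seq_scal_l _ (Cmod x) 0 Cmod_q_pow_lim).
    simpl in H. rewrite Rmult_0_r in H. apply is_lim_seq_spec in H.
    destruct (H (mkposreal (/ 2) ltac:(lra))) as [N HN]. exists N.
    specialize (HN N (Nat.le_refl N)). simpl in HN.
    rewrite Rminus_0_r in HN. apply Rabs_def2 in HN.
    rewrite Cmod_mult, Cmod_cpow. lra. }
  destruct HN as [N HN].
  (* The factor 2 is needed only for [n >= N]; it is used for both ranges so that one constant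
     serves. *)
  set (E := exp (2 * Cmod x / (1 - Cmod q))).
  assert (HE : 0 < E) by apply exp_pos.
  assert (Hpow : forall n, Cmod (x * cpow q n)%C <= Cmod x).
  { intros n. rewrite Cmod_mult, Cmod_cpow.
    assert (H2 : Cmod q ^ n <= 1) by (rewrite <- (pow1 n); apply pow_incr; lra).
    rewrite <- (Rmult_1_r (Cmod x)) at 2.
    apply Rmult_le_compat_l; [apply Cmod_ge_0|exact H2]. }
  assert (HN0 : 0 < Cmod (qpoch x q N)) by apply Cmod_gt_0, Hx.
  exists (Cmod (qpoch x q N) / E). split; [now apply Rdiv_lt_0_compat|].
  intros n. apply Rmult_le_reg_r with E; [exact HE|].
  unfold Rdiv. rewrite Rmult_assoc, Rinv_l, Rmult_1_r by lra.
  destruct (Nat.le_ge_cases n N) as [Hn|Hn].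
  - replace N with (n + (N - n))%nat by lia. rewrite qpoch_add, Cmod_mult.
    apply Rmult_le_compat_l; [apply Cmod_ge_0|].
    eapply Rle_trans; [apply (qpoch_le_rprod _ _ (2 * Cmod x))|].
    + specialize (Hpow n). assert (H := Cmod_ge_0 x). lra.
    + apply rprod_le_exp; [|lra]. assert (H := Cmod_ge_0 x). lra.
  - replace n with (N + (n - N))%nat by lia. rewrite qpoch_add, Cmod_mult.
    rewrite Rmult_assoc. rewrite <- (Rmult_1_r (Cmod (qpoch x q N))) at 1.
    apply Rmult_le_compat_l; [lra|].
    eapply Rle_trans; [apply (qpoch_lower_small _ (n - N) HN)|].
    apply Rmult_le_compat_l; [apply Cmod_ge_0|].
    assert (H := Cmod_ge_0 (x * cpow q N)%C). specialize (Hpow N).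
    eapply Rle_trans; [apply rprod_le_exp; lra|].
    apply exp_monotone. unfold Rdiv. apply Rmult_le_compat_r; [|lra].
    apply Rlt_le, Rinv_0_lt_compat; lra.
Qed.

(** The Newton basis with nodes [q, q^2, ...]: it extends [z^n (q/z)_n] to [z = 0]. *)
Fixpoint newton (n : nat) (z : C) : C :=
  match n with O => 1%C | S m => (newton m z * (z - cpow q (S m)))%C end.

Lemma newton_qpoch (z : C) n : z <> 0%C -> newton n z = (cpow z n * qpoch (q / z) q n)%C.
Proof.
  intros Hz; induction n as [|n IH]; simpl; [ring|].
  rewrite IH. field. exact Hz.
Qed.

(** * Norms of Newton polynomials and q-products on a disc *)

Section Disc.
Context (rho : R) (Hrho : 0 < rho).

Lemma wiener_newton M f n :
  wiener rho M f ->
  wiener rho (rho ^ n * rprod (Cmod q / rho) (Cmod q) n * M) (fun z => newton n z * f z)%C.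
Proof.
  intros H; induction n as [|n IH]; simpl.
  - apply wiener_ext with (3 := H); [lra|]. intros z _; ring.
  - eapply wiener_ext; [| |apply (wiener_mul_affine rho Hrho (- (q * cpow q n)) 1 _ _ IH)].
    + rewrite Cmod_1, Cmod_opp, Cmod_mult, Cmod_cpow. apply Req_le. field. lra.
    + intros z _; simpl; ring.
Qed.

Lemma wiener_qpoch (x : C) K M f n :
  Cmod x <= K -> wiener rho M f ->
  wiener rho (rprod (K * rho) (Cmod q) n * M) (fun z => qpoch (z * x) q n * f z)%C.
Proof.
  intros HK H; induction n as [|n IH]; simpl.
  - apply wiener_ext with (3 := H); [lra|]. intros z _; ring.
  - eapply wiener_ext;
      [| |apply (wiener_mul_affine rho Hrho 1 (- (x * cpow q n)) _ _ IH)].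
    + rewrite Cmod_1, Cmod_opp, Cmod_mult, Cmod_cpow.
      replace (rprod (K * rho) (Cmod q) n * (1 + K * rho * Cmod q ^ n) * M)
        with ((1 + K * Cmod q ^ n * rho) * (rprod (K * rho) (Cmod q) n * M)) by ring.
      apply Rmult_le_compat_r; [apply (wiener_ge_0 rho Hrho _ _ IH)|].
      apply Rplus_le_compat_l, Rmult_le_compat_r; [lra|].
      apply Rmult_le_compat_r; [apply pow_le, Cmod_ge_0|exact HK].
    + intros z _; simpl; ring.
Qed.

(** The 1 is the leading term of [1 - (1 - qpinf)], and the rest sums the norms of the series in
    [qpinf_series]. It depends only on the bound [K], so it is uniform over all the parameters
    [al q^n] needed at once in [lhs_cont]. *)
Definition qpinf_norm (K : R) : R :=
  1 + exp (K * rho / (1 - Cmod q)) * (K * rho) * / (1 - Cmod q).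

Lemma wiener_qpinf (x : C) K M f :
  Cmod x <= K -> wiener rho M f ->
  wiener rho (qpinf_norm K * M) (fun z => qpinf (z * x) q * f z)%C.
Proof.
  intros HK H.
  assert (HK0 : 0 <= K) by (eapply Rle_trans; [apply Cmod_ge_0|exact HK]).
  assert (HM := wiener_ge_0 rho Hrho _ _ H).
  set (E := exp (K * rho / (1 - Cmod q))).
  assert (Hs : wiener rho (E * (K * rho) * M * / (1 - Cmod q))
    (fun z => (1 - qpinf (z * x) q) * f z)%C).
  { apply (wiener_sum rho Hrho (fun n => E * (K * rho) * M * Cmod q ^ n) _
      (fun n z => qpoch (z * x) q n * (z * x * cpow q n) * f z)%C).
    - intros n.
      eapply wiener_ext; [| |apply (wiener_mul_id rho Hrho), (wiener_scal rho (x * cpow q n)%C),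
        (wiener_qpoch x K M f n HK H)].
      + rewrite Cmod_mult, Cmod_cpow.
        replace (rho * (Cmod x * Cmod q ^ n * (rprod (K * rho) (Cmod q) n * M)))
          with (rprod (K * rho) (Cmod q) n * Cmod x * (rho * M * Cmod q ^ n)) by ring.
        replace (E * (K * rho) * M * Cmod q ^ n) with (E * K * (rho * M * Cmod q ^ n)) by ring.
        assert (HKr : 0 <= K * rho) by (apply Rmult_le_pos; lra).
        apply Rmult_le_compat_r.
        * apply Rmult_le_pos; [apply Rmult_le_pos; lra|apply pow_le, Cmod_ge_0].
        * apply Rmult_le_compat; [|apply Cmod_ge_0| |exact HK].
          -- apply Rle_trans with 1; [lra|apply rprod_ge_1; lra].
          -- apply rprod_le_exp; lra.
      + intros z _; simpl; ring.
    - apply geom_series_scal.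
    - intros z _. rewrite (Cmult_comm (1 - qpinf (z * x) q)).
      eapply Cseries_ext; [|apply Cseries_scal, (proj1 (qpinf_series (z * x)%C))].
      intros n; simpl; ring. }
  eapply wiener_ext; [| |apply (wiener_plus rho Hrho _ _ _ _ H
    (wiener_scal rho (- (1))%C _ _ Hs))]; auto.
  - rewrite Cmod_m1. unfold qpinf_norm; fold E. apply Req_le. ring.
  - intros z _; simpl; ring.
Qed.
End Disc.
End Products.

(** * Continuation in [c] *)

Open Scope C_scope.

Lemma csum_ext (f g : nat -> C) : (forall n, f n = g n) -> csum f = csum g.
Proof.
  intros H. f_equal. now apply functional_extensionality.
Qed.

Lemma Cplus_opp_mult_eq_0 (x k y : C) : x + - k * y = 0 <-> x = k * y.
Proof.
  split; intros H.
  - replace x with (x + - k * y + k * y) by ring. rewrite H; ring.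
  - rewrite H; ring.
Qed.

Lemma qpoch_zero (x q : C) n : qpoch x q n = 0 -> exists j, x * cpow q j = 1.
Proof.
  induction n as [|n IH]; simpl; intros H; [now destruct C1_nz|].
  destruct (Ceq_dec (x * cpow q n) 1) as [E|E]; [now exists n|].
  apply IH. apply Cmult_cancel_l with (1 - x * cpow q n).
  - intros E'; apply E. replace (x * cpow q n) with (1 - (1 - x * cpow q n)) by ring.
    rewrite E'; ring.
  - rewrite Cmult_comm, H; ring.
Qed.

Section Continuation.
Context (q al a b be ga u v : C).
Context (Hq : (0 < Cmod q < 1)%R) (Ha : a <> 0) (Hb : b <> 0) (Hu : u <> 0) (Hv : v <> 0)
  (Hal : al <> 1).
Context (Hala : forall n, qpoch (al * a) q n <> 0)
  (Halb : forall n, qpoch (al * b) q n <> 0)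
  (Hqa : forall n, qpoch (q / a) q n <> 0)
  (Hqb : forall n, qpoch (q / b) q n <> 0)
  (Hw : forall n, qpoch (be * ga * u * v) q n <> 0)
  (Hbe : forall n, qpoch be q n <> 0) (Hga : forall n, qpoch ga q n <> 0)
  (HXbe : forall n, qpoch (al * be * a * b / q) q n <> 0)
  (HXga : forall n, qpoch (al * ga * a * b / q) q n <> 0)
  (HIa : qpinf (al * a) q <> 0) (HIb : qpinf (al * b) q <> 0)
  (HIw : qpinf (be * ga * u * v) q <> 0).

Lemma q_neq_0 : q <> 0.
Proof. apply Cmod_gt_0, Hq. Qed.

Lemma qq_neq_0 n : qpoch q q n <> 0.
Proof. apply qpoch_nz_of_small; apply Hq. Qed.

Lemma one_minus_al_neq_0 : 1 - al <> 0.
Proof.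
  intros E; apply Hal. replace al with (1 - (1 - al)) by ring. rewrite E; ring.
Qed.

Definition prefactor_const : C :=
  qpinf (q * al) q * qpinf (al * be * a * b / q) q * qpinf (al * ga * a * b / q) q
  / (qpinf (al * a) q * qpinf (al * b) q * qpinf (be * ga * u * v) q).

(** Nested to the right to match repeated use of [wiener_qpinf]. *)
Definition cleared_identity (c : C) : Prop :=
  qpinf (al * be * a * b * c / (q * q)) q * (qpinf (al * ga * a * b * c / (q * q)) q
    * (qpinf (al * c) q * csum (lhs_term q al a b c be ga u v)))
  = prefactor_const * (qpinf (al * a * c / q) q * (qpinf (al * b * c / q) q
    * (qpinf (be * ga * c * u * v / q) q * csum (rhs_phi_term q al a b c be ga u v)))).

(** Each product depending on [c] becomes a tail [(x q^N)_inf] of a product independent of [c],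
    except that of [al c], which is the tail of [(q al)_inf]. [qpinf_split] then supplies the finite
    symbols of [terminating_case]. *)
Lemma cleared_identity_terminating N :
  (forall n, qpoch (al * (q * cpow q N)) q n <> 0) -> cleared_identity (q * cpow q N).
Proof.
  intros Halc. unfold cleared_identity, prefactor_const.
  assert (Hq0 := q_neq_0).
  rewrite (terminating_case q qq_neq_0 al a b be ga u v N); auto.
  replace (al * be * a * b * (q * cpow q N) / (q * q))
    with (al * be * a * b / q * cpow q N) by (field; auto).
  replace (al * ga * a * b * (q * cpow q N) / (q * q))
    with (al * ga * a * b / q * cpow q N) by (field; auto).
  replace (al * (q * cpow q N)) with (al * q * cpow q N) by ring.
  replace (al * a * (q * cpow q N) / q) with (al * a * cpow q N) by (field; auto).
  replace (al * b * (q * cpow q N) / q) with (al * b * cpow q N) by (field; auto).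
  replace (be * ga * (q * cpow q N) * u * v / q)
    with (be * ga * u * v * cpow q N) by (field; auto).
  rewrite (Cmult_comm q al).
  rewrite (qpinf_split q Hq (al * q) N), (qpinf_split q Hq (al * be * a * b / q) N),
    (qpinf_split q Hq (al * ga * a * b / q) N).
  rewrite (qpinf_split q Hq (al * a) N) in HIa |- *.
  rewrite (qpinf_split q Hq (al * b) N) in HIb |- *.
  rewrite (qpinf_split q Hq (be * ga * u * v) N) in HIw |- *.
  assert (D : forall x y : C, x * y <> 0 -> x <> 0 /\ y <> 0).
  { intros x y H; split; intros E; apply H; rewrite E; ring. }
  destruct (D _ _ HIa), (D _ _ HIb), (D _ _ HIw).
  generalize (csum (rhs_phi_term q al a b (q * cpow q N) be ga u v)). intros S.
  field. auto 10.
Qed.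

Definition lhs_coef (n : nat) : C :=
  (1 - al * cpow q (2 * n)) * (qpoch al q n * qpoch (q / a) q n * qpoch (q / b) q n)
  / ((1 - al) * (qpoch q q n * qpoch (al * a) q n * qpoch (al * b) q n))
  * cpow (al * a * b / (q * q)) n
  * sum_n (fun k =>
      (qpoch (/ cpow q n) q k * qpoch (al * cpow q n) q k * qpoch be q k * qpoch ga q k * cpow q k)
      / (qpoch q q k * qpoch (q / a) q k * qpoch (q / b) q k * qpoch (be * ga * u * v) q k)
      * phi32 (/ cpow q k) (/ u) (/ v) be ga q (be * ga * u * v * cpow q k)) n.

Definition rhs_coef (n : nat) : C :=
  qpoch (al * a * b / (q * u)) q n * qpoch (al * a * b / (q * v)) q n
  / (qpoch q q n * qpoch (al * be * a * b / q) q n * qpoch (al * ga * a * b / q) q n)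
  * cpow (be * ga * u * v / q) n.

Lemma lhs_term_newton (c : C) n :
  c <> 0 -> qpoch (al * c) q n <> 0 ->
  lhs_term q al a b c be ga u v n = lhs_coef n * newton q n c / qpoch (al * c) q n.
Proof.
  intros Hc Hn. unfold lhs_term, lhs_coef. rewrite newton_qpoch by exact Hc.
  replace (al * a * b * c / (q * q)) with (c * (al * a * b / (q * q)))
    by (field; apply q_neq_0).
  rewrite cpow_mul.
  assert (H1 := qq_neq_0 n). assert (H2 := one_minus_al_neq_0).
  specialize (Hala n). specialize (Halb n).
  generalize (sum_n (fun k =>
      (qpoch (/ cpow q n) q k * qpoch (al * cpow q n) q k * qpoch be q k * qpoch ga q k * cpow q k)
      / (qpoch q q k * qpoch (q / a) q k * qpoch (q / b) q k * qpoch (be * ga * u * v) q k)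
      * phi32 (/ cpow q k) (/ u) (/ v) be ga q (be * ga * u * v * cpow q k)) n : C).
  intros S. field. auto.
Qed.

Lemma rhs_term_newton (c : C) n :
  c <> 0 -> rhs_phi_term q al a b c be ga u v n = rhs_coef n * newton q n c.
Proof.
  intros Hc. unfold rhs_phi_term, phi32_term, rhs_coef. rewrite newton_qpoch by exact Hc.
  replace (be * ga * c * u * v / q) with (c * (be * ga * u * v / q))
    by (field; apply q_neq_0).
  rewrite cpow_mul.
  assert (H1 := qq_neq_0 n). specialize (HXbe n). specialize (HXga n).
  field. auto.
Qed.

(** Multiplying each term by [(al z)_inf] turns [1/(al z)_n] into an entire factor. The trailing 1
    is the constant function from which the norm bounds are built up. *)
Definition lhs_cont (z : C) : C :=
  csum (fun n => lhs_coef n * (newton q n z * (qpinf (z * (al * cpow q n)) q * 1))).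

Definition rhs_cont (z : C) : C := csum (fun n => rhs_coef n * (newton q n z * 1)).

Lemma lhs_cont_eq (c : C) :
  c <> 0 -> (forall n, qpoch (al * c) q n <> 0) ->
  is_series (lhs_term q al a b c be ga u v) (csum (lhs_term q al a b c be ga u v)) ->
  lhs_cont c = qpinf (al * c) q * csum (lhs_term q al a b c be ga u v).
Proof.
  intros Hc Hn Hs. apply csum_unique.
  eapply Cseries_ext; [|apply Cseries_scal, Hs].
  intros n; cbv beta. rewrite lhs_term_newton by auto.
  rewrite (qpinf_split q Hq (al * c) n).
  replace (c * (al * cpow q n)) with (al * c * cpow q n) by ring.
  specialize (Hn n). field. exact Hn.
Qed.

Lemma rhs_cont_eq (c : C) :
  c <> 0 -> rhs_cont c = csum (rhs_phi_term q al a b c be ga u v).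
Proof.
  intros Hc. apply csum_ext. intros n. rewrite rhs_term_newton by exact Hc. ring.
Qed.

(** The norm of [newton q n] on the disc is at most a constant times [|c|^n], and [|newton q n c|]
    is at least a constant times [|c|^n] by [qpoch_lower]. Convergence at one point thus bounds the
    sum of norms. *)
Lemma newton_summable (c : C) (x : nat -> C) :
  c <> 0 -> (forall n, qpoch (q / c) q n <> 0) ->
  ex_series (fun n => Cmod (x n * newton q n c)) ->
  ex_series (fun n => Cmod (x n) * (Cmod c ^ n * rprod (Cmod q / Cmod c) (Cmod q) n))%R.
Proof.
  intros Hc Hn Hs. destruct (qpoch_lower q Hq (q / c) Hn) as [d [Hd Hdn]].
  assert (Hc' : (0 < Cmod c)%R) by now apply Cmod_gt_0.
  set (E := exp (Cmod q / Cmod c / (1 - Cmod q))).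
  apply (ex_series_le (K := R_AbsRing) (V := R_CompleteNormedModule) _
    (fun n => (E / d) * Cmod (x n * newton q n c))%R).
  - intros n.
    assert (HQ : (0 <= Cmod q / Cmod c)%R) by (apply Rdiv_le_0_compat; lra).
    assert (R1 := rprod_ge_1 (Cmod q / Cmod c) (Cmod q) n HQ ltac:(lra)).
    assert (R2 : (rprod (Cmod q / Cmod c) (Cmod q) n <= E)%R)
      by (apply rprod_le_exp; [exact HQ|lra]).
    change (Rabs (Cmod (x n) * (Cmod c ^ n * rprod (Cmod q / Cmod c) (Cmod q) n))
      <= E / d * Cmod (x n * newton q n c))%R.
    assert (P : (0 <= Cmod (x n) * Cmod c ^ n)%R)
      by (apply Rmult_le_pos; [apply Cmod_ge_0|apply pow_le, Cmod_ge_0]).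
    rewrite Rabs_pos_eq.
    2:{ rewrite <- Rmult_assoc. apply Rmult_le_pos; lra. }
    rewrite newton_qpoch by exact Hc. rewrite !Cmod_mult, Cmod_cpow.
    replace (E / d * (Cmod (x n) * (Cmod c ^ n * Cmod (qpoch (q / c) q n))))%R
      with (Cmod (x n) * Cmod c ^ n * (E * (Cmod (qpoch (q / c) q n) / d)))%R
      by (field; lra).
    rewrite <- Rmult_assoc. apply Rmult_le_compat_l; [exact P|].
    apply Rle_trans with (1 := R2). rewrite <- (Rmult_1_r E) at 1.
    apply Rmult_le_compat_l; [lra|].
    apply Rmult_le_reg_r with d; [exact Hd|].
    unfold Rdiv. rewrite Rmult_assoc, Rinv_l by lra. specialize (Hdn n). lra.
  - now apply (ex_series_scal (K := R_AbsRing) (V := R_NormedModule)).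
Qed.

Lemma cleared_identity_nonterminating (c : C) :
  c <> 0 -> (forall n, qpoch (al * c) q n <> 0) -> (forall n, qpoch (q / c) q n <> 0) ->
  ex_series (fun n => Cmod (lhs_term q al a b c be ga u v n)) ->
  ex_series (fun n => Cmod (rhs_phi_term q al a b c be ga u v n)) ->
  cleared_identity c.
Proof.
  intros Hc Halc Hqc HL HR.
  set (rho := Cmod c). assert (Hrho : (0 < rho)%R) by now apply Cmod_gt_0.
  assert (Hq0 := q_neq_0).
  (* Clearing the denominator [(al c)_n] costs only a bounded factor. *)
  assert (SL : ex_series (fun n => Cmod (lhs_coef n * newton q n c))).
  { apply (ex_series_le (K := R_AbsRing) (V := R_CompleteNormedModule) _
      (fun n => exp (Cmod (al * c) / (1 - Cmod q))
                * Cmod (lhs_term q al a b c be ga u v n))%R).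
    - intros n. change (Rabs (Cmod (lhs_coef n * newton q n c))
        <= exp (Cmod (al * c) / (1 - Cmod q)) * Cmod (lhs_term q al a b c be ga u v n))%R.
      rewrite Rabs_pos_eq by apply Cmod_ge_0.
      replace (lhs_coef n * newton q n c)
        with (qpoch (al * c) q n * lhs_term q al a b c be ga u v n)
        by (rewrite lhs_term_newton by auto; field; auto).
      rewrite (Cmod_mult (qpoch _ _ _)). apply Rmult_le_compat_r; [apply Cmod_ge_0|].
      now apply qpoch_bounded.
    - now apply (ex_series_scal (K := R_AbsRing) (V := R_NormedModule)). }
  assert (SR : ex_series (fun n => Cmod (rhs_coef n * newton q n c))).
  { eapply ex_series_ext; [|exact HR]. intros n; cbv beta. now rewrite rhs_term_newton. }
  apply (newton_summable c _ Hc Hqc) in SL. apply (newton_summable c _ Hc Hqc) in SR.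
  fold rho in SL, SR.
  assert (WL : exists L, wiener rho L lhs_cont).
  { apply (wiener_csum rho Hrho (fun n => Cmod (lhs_coef n)
      * (rho ^ n * rprod (Cmod q / rho) (Cmod q) n
         * (qpinf_norm q rho (Cmod al) * Cmod 1)))%R).
    - intros n. apply wiener_scal, wiener_newton, wiener_qpinf; auto.
      + rewrite Cmod_mult, Cmod_cpow. rewrite <- (Rmult_1_r (Cmod al)) at 2.
        apply Rmult_le_compat_l; [apply Cmod_ge_0|].
        rewrite <- (pow1 n). apply pow_incr; lra.
      + apply wiener_const.
    - apply (ex_series_scal_r (qpinf_norm q rho (Cmod al) * Cmod 1)%R) in SL.
      eapply ex_series_ext; [|exact SL]. intros n; cbv beta. now rewrite !Rmult_assoc. }
  assert (WR : exists L, wiener rho L rhs_cont).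
  { apply (wiener_csum rho Hrho (fun n => Cmod (rhs_coef n)
      * (rho ^ n * rprod (Cmod q / rho) (Cmod q) n * Cmod 1))%R).
    - intros n. apply wiener_scal, wiener_newton; auto. apply wiener_const.
    - apply (ex_series_scal_r (Cmod 1)) in SR.
      eapply ex_series_ext; [|exact SR]. intros n; cbv beta. now rewrite !Rmult_assoc. }
  destruct WL as [ML WL]. destruct WR as [MR WR].
  assert (WQ : forall x M f, wiener rho M f ->
    exists M', wiener rho M' (fun z => qpinf (z * x) q * f z)).
  { intros x M f H. eexists. apply (wiener_qpinf q Hq rho Hrho x _ M f (Rle_refl _) H). }
  set (A z := qpinf (z * (al * be * a * b / (q * q))) q
    * (qpinf (z * (al * ga * a * b / (q * q))) q * lhs_cont z)).
  set (B z := qpinf (z * (al * a / q)) q * (qpinf (z * (al * b / q)) q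
    * (qpinf (z * (be * ga * u * v / q)) q * rhs_cont z))).
  assert (WA : exists M, wiener rho M A).
  { destruct (WQ (al * ga * a * b / (q * q)) _ _ WL) as [M1 W1].
    exact (WQ (al * be * a * b / (q * q)) _ _ W1). }
  assert (WB : exists M, wiener rho M B).
  { destruct (WQ (be * ga * u * v / q) _ _ WR) as [M1 W1].
    destruct (WQ (al * b / q) _ _ W1) as [M2 W2].
    exact (WQ (al * a / q) _ _ W2). }
  destruct WA as [MA WA]. destruct WB as [MB WB].
  assert (WH := wiener_plus rho Hrho _ _ _ _ WA
    (wiener_scal rho (- prefactor_const) _ _ WB)).
  assert (Hiff : forall z : C, z <> 0 -> (forall n, qpoch (al * z) q n <> 0) ->
    is_series (lhs_term q al a b z be ga u v) (csum (lhs_term q al a b z be ga u v)) ->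
    (A z + - prefactor_const * B z = 0 <-> cleared_identity z)).
  { intros z Hz Hn Hs. unfold A, B, cleared_identity.
    rewrite (lhs_cont_eq z Hz Hn Hs), (rhs_cont_eq z Hz).
    replace (z * (al * be * a * b / (q * q))) with (al * be * a * b * z / (q * q))
      by (field; auto).
    replace (z * (al * ga * a * b / (q * q))) with (al * ga * a * b * z / (q * q))
      by (field; auto).
    replace (z * (al * a / q)) with (al * a * z / q) by (field; auto).
    replace (z * (al * b / q)) with (al * b * z / q) by (field; auto).
    replace (z * (be * ga * u * v / q)) with (be * ga * z * u * v / q) by (field; auto).
    apply Cplus_opp_mult_eq_0. }
  (* The threshold puts [x n] in the disc and forces [|al x n| < 1], so that no [(al x n)_k]
     vanishes. *)
  destruct (proj2 (is_lim_seq_spec _ 0) (Cmod_q_pow_lim q Hq)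
    (mkposreal _ (Rmin_pos _ _ Hrho
      (Rinv_0_lt_compat (1 + Cmod al) ltac:(assert (H := Cmod_ge_0 al); lra)))))
    as [N0 HN0].
  simpl in HN0.
  set (x n := q * cpow q (N0 + n)).
  assert (Hxmod : forall n, (Cmod (x n) = Cmod q ^ (N0 + S n))%R).
  { intros n. unfold x. rewrite Cmod_mult, Cmod_cpow, Nat.add_succ_r. reflexivity. }
  assert (Hxs : forall n, (Cmod (x n) < Rmin rho (/ (1 + Cmod al)))%R).
  { intros n. rewrite Hxmod. specialize (HN0 (N0 + S n)%nat ltac:(lia)).
    rewrite Rminus_0_r in HN0. apply Rabs_def2 in HN0. apply HN0. }
  assert (Hx0 : forall n, x n <> 0).
  { intros n. unfold x. apply Cmult_neq_0; [exact Hq0|now apply cpow_nz]. }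
  apply Hiff; [exact Hc|exact Halc| |].
  { apply Cseries_abs with (2 := HL). intros n; apply Rle_refl. }
  apply (wiener_zero rho Hrho _ _ x WH); [exact Hx0| | | |apply Rle_refl].
  - intros n. apply Rlt_le, Rlt_le_trans with (1 := Hxs n), Rmin_l.
  - intros n. cbv beta.
    assert (Hn : forall k, qpoch (al * x n) q k <> 0).
    { apply qpoch_nz_of_small; [exact Hq|]. rewrite Cmod_mult.
      assert (H := Rlt_le_trans _ _ _ (Hxs n) (Rmin_r _ _)).
      assert (H0 := Cmod_ge_0 al). assert (H1 := Cmod_ge_0 (x n)).
      apply Rle_lt_trans with ((1 + Cmod al) * Cmod (x n))%R; [lra|].
      apply Rmult_lt_reg_l with (/ (1 + Cmod al))%R; [apply Rinv_0_lt_compat; lra|].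
      rewrite <- Rmult_assoc, Rinv_l, Rmult_1_l, Rmult_1_r by lra. exact H. }
    apply Hiff; [apply Hx0|exact Hn| |now apply cleared_identity_terminating].
    (* At [x n] the left-hand series is finite, so its convergence needs no further hypothesis. *)
    assert (V : forall k, (N0 + n < k)%nat -> lhs_term q al a b (x n) be ga u v k = 0).
    { intros k Hk. unfold lhs_term.
      replace (q / x n) with (/ cpow q (N0 + n))
        by (unfold x; field; split; [now apply cpow_nz|exact Hq0]).
      rewrite (qpoch_neg_vanish q (N0 + n) k Hq0 Hk). unfold Cdiv; ring. }
    rewrite (csum_finite _ _ V). now apply Cseries_finite.
  - eapply is_lim_seq_ext; [intros n; symmetry; apply Hxmod|].
    apply (is_lim_seq_ext (fun n => Cmod q ^ (n + S N0))%R).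
    + intros n. f_equal. lia.
    + apply (is_lim_seq_incr_n (fun n => Cmod q ^ n)%R (S N0)). now apply Cmod_q_pow_lim.
Qed.
End Continuation.

Theorem theorem1p4 (q al a b c be ga u v : C) :
  0 < Cmod q < 1 ->
  (* well-definedness: no division by zero anywhere in the identity *)
  a <> 0 -> b <> 0 -> c <> 0 -> u <> 0 -> v <> 0 -> al <> 1 ->
  (forall n, qpoch (al * a) q n <> 0) -> (forall n, qpoch (al * b) q n <> 0) ->
  (forall n, qpoch (al * c) q n <> 0) -> (forall n, qpoch (q / a) q n <> 0) ->
  (forall n, qpoch (q / b) q n <> 0) -> (forall n, qpoch (be * ga * u * v) q n <> 0) ->
  (forall n, qpoch be q n <> 0) -> (forall n, qpoch ga q n <> 0) ->
  (forall n, qpoch (al * be * a * b / q) q n <> 0) ->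
  (forall n, qpoch (al * ga * a * b / q) q n <> 0) ->
  qpinf (al * a) q <> 0 -> qpinf (al * b) q <> 0 -> qpinf (al * c) q <> 0 ->
  qpinf (al * be * a * b * c / (q * q)) q <> 0 ->
  qpinf (al * ga * a * b * c / (q * q)) q <> 0 ->
  qpinf (be * ga * u * v) q <> 0 ->
  (* both sides converge absolutely *)
  ex_series (fun n => Cmod (lhs_term q al a b c be ga u v n)) ->
  ex_series (fun n => Cmod (rhs_phi_term q al a b c be ga u v n)) ->
  csum (lhs_term q al a b c be ga u v)
  = rhs_prefactor q al a b c be ga u v * csum (rhs_phi_term q al a b c be ga u v).
Proof.
  intros Hq Ha Hb Hc Hu Hv Hal Hala Halb Halc Hqa Hqb Hw Hbe Hga HXbe HXga
    HIa HIb HIc HIbe HIga HIw HL HR.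
  assert (Hq0 := q_neq_0 q Hq).
  assert (K : cleared_identity q al a b be ga u v c).
  (* A vanishing [(q/c)_n] means that [c = q^(N+1)]: the lower bound behind the continuation is then
     lost, but the terminating identity applies at [c] itself. *)
  { destruct (classic (forall n, qpoch (q / c) q n <> 0)) as [Hqc|Hqc].
    - now apply cleared_identity_nonterminating.
    - apply not_all_not_ex in Hqc. destruct Hqc as [n Hn].
      destruct (qpoch_zero _ _ _ Hn) as [N HN].
      assert (E : c = q * cpow q N).
      { rewrite <- (Cmult_1_r c), <- HN. field. exact Hc. }
      rewrite E in Halc |- *. now apply cleared_identity_terminating. }
  unfold cleared_identity, prefactor_const in K. unfold rhs_prefactor.
  unfold rhs_phi_term in K |- *.
  apply Cmult_cancel_l with (qpinf (al * be * a * b * c / (q * q)) q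
    * (qpinf (al * ga * a * b * c / (q * q)) q * qpinf (al * c) q)).
  { now repeat apply Cmult_neq_0. }
  etransitivity; [|etransitivity; [exact K|]]; [ring|]. field. auto 10.
Qed.
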